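(* Let $\Phi_R:\mathbb{R}^d\to\mathbb{R}$ be the regularized misfit, let $\rho_\infty(u)=e^{-\Phi_R(u)}/\int_{\mathbb{R}^d} e^{-\Phi_R(v)}\,dv$, and consider the nonlinear Fokker-Planck equation $$\partial_t \rho = \nabla\cdot\bigl(\rho\,\mathcal{C}(\rho)\nabla\Phi_R(u)+\rho\,\mathcal{C}(\rho)\nabla\ln\rho\bigr),\qquad t>0,\ u\in\mathbb{R}^d. \qquad ( * )$$ Let $\rho(t)$ be a solution of $( * )$ with initial condition $\rho_0$ satisfying $\mathrm{KL}(\rho_0\|\rho_\infty)<\infty$. Assume there exist $\alpha>0$ and $\lambda>0$ such that $$\mathcal{C}(\rho(t))\ge \alpha I_d \ \text{ for all } t\ge 0,\qquad D^2\Phi_R(u)\ge\lambda I_d\ \text{ for all } u\in\mathbb{R}^d .$$ Then $\rho(t)$ decays exponentially fast to equilibrium: there exists a constant $c=c(\rho_0,\Phi_R)>0$ such that for any $t>0$, $$\|\rho(t)-\rho_\infty\|_{L^1(\mathbb{R}^d)}\le c\,e^{-\alpha\lambda t}.$$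
   Context: Setting: $\mathcal{G}:\mathbb{R}^d\to\mathbb{R}^K$ is a given forward map, $y\in\mathbb{R}^K$ is given data, $\Gamma\in\mathbb{R}^{K\times K}$ and $\Gamma_0\in\mathbb{R}^{d\times d}$ are symmetric strictly positive-definite covariance matrices. For symmetric positive-definite $A$, $\|a\|_A=\|A^{-1/2}a\|$ (Euclidean norm on the right). The regularized misfit is $\Phi_R(u)=\frac12\|y-\mathcal{G}(u)\|_\Gamma^2+\frac12\|u\|_{\Gamma_0}^2$, and $D^2\Phi_R$ is its Hessian. For a probability density $\rho$ on $\mathbb{R}^d$ with finite second moment, its mean and covariance are $$m(\rho)=\int v\,\rho(v)\,dv,\qquad \mathcal{C}(\rho)=\int (v-m(\rho))\otimes(v-m(\rho))\,\rho(v)\,dv\in\mathbb{R}^{d\times d}.$$ Matrix inequalities are in the sense of symmetric positive semi-definite (Loewner) order; $I_d$ is the identity. The relative entropy is $\mathrm{KL}(\rho\|\rho_\infty)=\int\rho\ln(\rho/\rho_\infty)\,du$. A solution of $( * )$ is a curve $t\mapsto\rho(t)$ of probability densities with finite second moment satisfying $( * )$ with $\rho(0)=\rho_0$; it is understood to be sufficiently regular and decaying at infinity that integrations by parts are justified. *)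

(* Defs.v *)
From HB Require Import structures.
From mathcomp Require Import all_boot all_order all_algebra.
From mathcomp Require Import all_classical all_reals all_analysis.

Set Implicit Arguments.
Unset Strict Implicit.
Unset Printing Implicit Defensive.

Import Order.TTheory GRing.Theory Num.Theory.
Import numFieldNormedType.Exports.

Local Open Scope classical_set_scope.
Local Open Scope ring_scope.

(** Points of R^d are row vectors ['rV[R]_d].  Their sigma-algebra is the one
    generated by the coordinates, i.e. the Borel sigma-algebra. *)

Section measurable_rV.
Context {d} {T : sigmaRingType d} (n : nat).

Let coors : 'I_n -> 'rV[T]_n -> T := fun i v => v ord0 i.

Let rV_set0 : g_sigma_preimage coors set0.
Proof. exact: sigma_algebra0. Qed.

Let rV_setC A : g_sigma_preimage coors A -> g_sigma_preimage coors (~` A).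
Proof. exact: sigma_algebraC. Qed.

Let rV_bigcup (F : _^nat) : (forall i, g_sigma_preimage coors (F i)) ->
  g_sigma_preimage coors (\bigcup_i (F i)).
Proof. exact: sigma_algebra_bigcup. Qed.

HB.instance Definition _ := @isMeasurable.Build (measure_tuple_display d)
  ('rV[T]_n) (g_sigma_preimage coors) rV_set0 rV_setC rV_bigcup.

End measurable_rV.

Lemma measurable_coord d (T : sigmaRingType d) n (i : 'I_n) :
  measurable_fun [set: 'rV[T]_n] (fun v : 'rV[T]_n => v ord0 i).
Proof.
move=> _ Y mY; rewrite setTI; apply: sub_sigma_algebra => /=.
rewrite -bigcup_seq/=; exists i => /=; first by rewrite mem_index_enum.
by exists Y => //; rewrite setTI.
Qed.

Lemma measurable_fun_coordP d1 d2 (T1 : measurableType d1)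
    (T2 : measurableType d2) n (f : T1 -> 'rV[T2]_n) :
  measurable_fun [set: T1] f <->
  forall i, measurable_fun [set: T1] (fun x => f x ord0 i).
Proof.
apply: (@iff_trans _ (g_sigma_preimage
    (fun i => (fun v : 'rV[T2]_n => v ord0 i) \o f) `<=` measurable)).
  rewrite (@g_sigma_preimage_comp _ _ _ 'rV[T2]_n); split=> [mf A [/= C preC <-]|prefS].
    exact: mf.
  by move=> _ A mA; apply: prefS; exists A.
split=> [coordS i|mf].
- move=> _ A mA.
  apply: coordS; apply: sub_sigma_algebra.
  case: n => [|n] in f i *; first by case: i.
  rewrite -bigcup_mkord_ord.
  exists i; first exact: ltn_ord.
  by exists A => //; rewrite inord_val.
- apply: smallest_sub; first exact: sigma_algebra_measurable.
  case: n => [|n] in f mf *; first by rewrite big_ord0.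
  rewrite -bigcup_mkord_ord; apply: bigcup_sub => i Ii.
  by move=> A [B mB <-]; exact: mf.
Qed.

Section lebesgue_rV.
Context {R : realType}.

Definition rV_cons n (p : measurableTypeR R * 'rV[R]_n) : 'rV[R]_n.+1 :=
  row_mx (p.1 : R)%:M p.2.

Definition rV_uncons n (v : 'rV[R]_n.+1) : measurableTypeR R * 'rV[R]_n :=
  (v ord0 ord0, rsubmx (v : 'rV[R]_(1 + n))).

Lemma rV_cons0 n (p : measurableTypeR R * 'rV[R]_n) :
  rV_cons p ord0 ord0 = p.1.
Proof. by rewrite /rV_cons mxE; case: splitP => // j _; rewrite mxE !ord1 mulr1n. Qed.

Lemma rV_consK n : cancel (@rV_cons n) (@rV_uncons n).
Proof. by move=> p; rewrite /rV_uncons rV_cons0 row_mxKr; case: p. Qed.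

Lemma rV_unconsK n : cancel (@rV_uncons n) (@rV_cons n).
Proof.
move=> v; rewrite /rV_cons /rV_uncons /=.
have -> : (v ord0 ord0)%:M = lsubmx (v : 'rV[R]_(1 + n)).
  apply/matrixP => i j; rewrite !ord1 !mxE mulr1n; congr (v _ _).
  exact/val_inj.
exact: (@hsubmxK R 1 1 n v).
Qed.

Lemma measurable_rV_cons n : measurable_fun setT (@rV_cons n).
Proof.
apply/measurable_fun_coordP => i; have [j ->|j ->] := @split_ordP 1 n i.
  have -> : (fun p : measurableTypeR R * 'rV[R]_n =>
      rV_cons p ord0 (lshift n j)) = fst.
    apply/funext => p; apply: etrans (row_mxEl _ _ _ _) _.
    by rewrite !ord1 mxE mulr1n.
  exact: measurable_fst.
have -> : (fun p : measurableTypeR R * 'rV[R]_n =>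
    rV_cons p ord0 (rshift 1 j)) = (fun v : 'rV[R]_n => v ord0 j) \o snd.
  by apply/funext => p; exact: (row_mxEr _ _ _ _).
by apply: measurableT_comp => //; exact: measurable_coord.
Qed.

Lemma measurable_rV_uncons n : measurable_fun setT (@rV_uncons n).
Proof.
apply/measurable_fun_pairP; split; first exact: measurable_coord.
apply/measurable_fun_coordP => i; rewrite (_ : (fun _ => _) =
  (fun v : 'rV[R]_n.+1 => v ord0 (rshift 1 i))).
  exact: measurable_coord.
by apply/funext => v /=; rewrite mxE.
Qed.

Section step.
Variables (n : nat) (mu : {sigma_finite_measure set 'rV[R]_n -> \bar R}).
Local Open Scope ereal_scope.

Definition lebesgue_rV_step : set 'rV[R]_n.+1 -> \bar R :=
  pushforward (@lebesgue_measure R \x mu) (@rV_cons n).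

Let m_cons A : measurable A -> measurable (@rV_cons n @^-1` A).
Proof. by move=> mA; rewrite -[X in measurable X]setTI; exact: measurable_rV_cons. Qed.

Let step0 : lebesgue_rV_step set0 = 0.
Proof. by rewrite /lebesgue_rV_step /pushforward preimage_set0 measure0. Qed.

Let step_ge0 A : 0 <= lebesgue_rV_step A.
Proof. by rewrite /lebesgue_rV_step /pushforward measure_ge0. Qed.

Let step_sigma_additive : semi_sigma_additive lebesgue_rV_step.
Proof.
move=> F mF tF mUF; rewrite /lebesgue_rV_step /pushforward preimage_bigcup.
apply: measure_semi_sigma_additive.
- by move=> i; exact: m_cons.
- apply/trivIsetP => /= i j _ _ ij; rewrite -preimage_setI.
  by move/trivIsetP : tF => /(_ _ _ _ _ ij) ->//; rewrite preimage_set0.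
- by rewrite -preimage_bigcup; exact: m_cons.
Qed.

HB.instance Definition _ := isMeasure.Build _ _ _ lebesgue_rV_step
  step0 step_ge0 step_sigma_additive.

Let step_sigma_finite : sigma_finite setT lebesgue_rV_step.
Proof.
have /sigma_finiteP[F [TF ndF Foo]] := sigma_finiteT (@lebesgue_measure R).
have /sigma_finiteP[G [TG ndG Goo]] := sigma_finiteT mu.
exists (fun k => @rV_uncons n @^-1` (F k `*` G k)).
  apply/esym; rewrite -subTset => v _.
  have [i _ Fi] : (\bigcup_i F i) (rV_uncons v).1 by rewrite -TF.
  have [j _ Gj] : (\bigcup_i G i) (rV_uncons v).2 by rewrite -TG.
  exists (maxn i j) => //; split.
  - by move: Fi; exact/subsetPset/ndF/leq_maxl.
  - by move: Gj; exact/subsetPset/ndG/leq_maxr.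
move=> k; have [mF Fk] := Foo k; have [mG Gk] := Goo k; split.
  by rewrite -[X in measurable X]setTI; apply: measurable_rV_uncons => //; exact: measurableX.
rewrite /lebesgue_rV_step /pushforward -comp_preimage.
have -> : @rV_uncons n \o @rV_cons n = id by apply/funext => p; exact: rV_consK.
rewrite preimage_id product_measure1E// lte_mul_pinfty// ge0_fin_numE//.
Qed.

HB.instance Definition _ := Measure_isSigmaFinite.Build _ _ _ lebesgue_rV_step
  step_sigma_finite.

End step.

Fixpoint lebesgue_rV n : {sigma_finite_measure set 'rV[R]_n -> \bar R} :=
  match n with
  | 0 => dirac (0 : 'rV[R]_0)
  | n'.+1 => lebesgue_rV_step (lebesgue_rV n')
  end.

End lebesgue_rV.

Lemma lebesgue_rV_box (R : realType) n (A : 'I_n -> set (measurableTypeR R)) :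
  (forall i, measurable (A i)) ->
  lebesgue_rV n [set v : 'rV[R]_n | forall i, A i (v ord0 i)] =
  (\prod_(i < n) lebesgue_measure (A i))%E.
Proof.
elim: n A => [|n IH] A mA.
  have -> : [set v : 'rV[R]_0 | forall i, A i (v ord0 i)] = setT.
    by apply/seteqP; split => // v _ [].
  by rewrite big_ord0 /= diracT.
have mB : measurable [set v : 'rV[R]_n | forall i, A (lift ord0 i) (v ord0 i)].
  rewrite (_ : [set _ | _] = \bigcap_(i in [set: 'I_n])
      ((fun v : 'rV[R]_n => v ord0 i) @^-1` A (lift ord0 i))).
    apply: fin_bigcap_measurable => [|i _]; first exact: finite_finset.
    by rewrite -[X in measurable X]setTI; apply: (measurable_coord i) => //; exact: mA.
  by apply/seteqP; split => v /= h i; [move=> _; exact: h|exact: h].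
rewrite big_ord_recl /= -IH; last by move=> i; exact: mA.
rewrite /lebesgue_rV_step /pushforward -product_measure1E//.
congr product_measure1; apply/seteqP; split => -[x v] /= h.
- split => [|i]; first by have := h ord0; rewrite rV_cons0.
  have := h (lift ord0 i); congr (A _ _).
  rewrite (_ : lift ord0 i = rshift 1 i); last exact/val_inj.
  exact: (row_mxEr _ _ _ _).
- move=> i; have [j ->|->] := unliftP ord0 i; last first.
    by rewrite rV_cons0; case: h.
  case: h => _ /(_ j); congr (A _ _); apply/esym.
  rewrite (_ : lift ord0 j = rshift 1 j); last exact/val_inj.
  exact: (row_mxEr _ _ _ _).
Qed.

Section matrices.
Context {R : realType}.

Definition enorm n (a : 'rV[R]_n) : R := Num.sqrt (\sum_i a ord0 i ^+ 2).

Definition qform n (A : 'M[R]_n) (x : 'rV[R]_n) : R :=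
  (x *m A *m x^T) ord0 ord0.

Definition psd n (A : 'M[R]_n) : Prop :=
  A^T = A /\ forall x : 'rV[R]_n, 0 <= qform A x.

Definition spd n (A : 'M[R]_n) : Prop :=
  A^T = A /\ forall x : 'rV[R]_n, x != 0 -> 0 < qform A x.

Definition loewner_le n (A B : 'M[R]_n) : Prop := psd (B - A).

(** For [spd A] this is the square root A^{1/2}: it exists and is unique. *)
Definition mxsqrt n (A : 'M[R]_n) : 'M[R]_n :=
  get [set B : 'M[R]_n | spd B /\ B *m B = A].

(** |A^{-1/2} a|; the product is on the right since vectors are rows, and
    A^{-1/2} is symmetric. *)
Definition wnorm n (A : 'M[R]_n) (a : 'rV[R]_n) : R :=
  enorm (a *m invmx (mxsqrt A)).

End matrices.

Section operators.
Context {R : realType} {d : nat}.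
Implicit Types (f : 'rV[R]_d -> R) (F : 'rV[R]_d -> 'rV[R]_d).

Definition partial (i : 'I_d) f (u : 'rV[R]_d) : R := 'D_(delta_mx ord0 i) f u.

Definition grad f (u : 'rV[R]_d) : 'rV[R]_d := \row_i partial i f u.

Definition hessian f (u : 'rV[R]_d) : 'M[R]_d :=
  \matrix_(i, j) partial i (partial j f) u.

Definition divergence F (u : 'rV[R]_d) : R :=
  \sum_i partial i (fun v => F v ord0 i) u.

Definition C1 f : Prop :=
  (forall u, differentiable f u) /\ forall i, continuous (partial i f).

Definition C2 f : Prop := C1 f /\ forall i, C1 (partial i f).

End operators.

Section densities.
Context {R : realType} {d : nat}.
Implicit Types (f g : 'rV[R]_d -> R).
Local Notation mu := (@lebesgue_rV R d).

Definition density2 f : Prop :=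
  [/\ measurable_fun setT f, (forall u, 0 <= f u),
      (\int[mu]_u (f u)%:E = 1)%E
    & (\int[mu]_u (enorm u ^+ 2 * f u)%:E < +oo)%E].

Definition mean_rV f : 'rV[R]_d := \row_i \int[mu]_v (v ord0 i * f v).

Definition covmx f : 'M[R]_d := \matrix_(i, j)
  \int[mu]_v ((v ord0 i - mean_rV f ord0 i) * (v ord0 j - mean_rV f ord0 j) * f v).

(** For densities the negative part of the integrand is integrable, so the
    integral is never of the form +oo - oo. *)
Definition KL f g : \bar R := (\int[mu]_u (f u * ln (f u / g u))%:E)%E.

Definition L1dist f g : \bar R := ('N[mu]_1[EFin \o (f \- g)%R])%E.

Definition gibbs (Phi : 'rV[R]_d -> R) (u : 'rV[R]_d) : R :=
  expR (- Phi u) / \int[mu]_v expR (- Phi v).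

End densities.

Definition misfitR (R : realType) d K (G : 'rV[R]_d -> 'rV[R]_K) (y : 'rV[R]_K)
    (Gamma : 'M[R]_K) (Gamma0 : 'M[R]_d) (u : 'rV[R]_d) : R :=
  2^-1 * wnorm Gamma (y - G u) ^+ 2 + 2^-1 * wnorm Gamma0 u ^+ 2.

Section fokker_planck.
Context {R : realType} {d : nat}.
Variable Phi : 'rV[R]_d -> R.
Implicit Types (r : 'rV[R]_d -> R) (rho : R -> 'rV[R]_d -> R).
Local Notation mu := (@lebesgue_rV R d).

(** r C(r) grad Phi + r C(r) grad (ln r), as a row vector (C(r) is symmetric). *)
Definition fp_flux r (u : 'rV[R]_d) : 'rV[R]_d :=
  r u *: (grad Phi u *m covmx r) +
  r u *: (grad (fun v => ln (r v)) u *m covmx r).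

(** Positivity and smoothness for positive times, which give the terms of the
    equation their classical meaning, and decay at infinity:
    [fp_dom] lets one differentiate the entropy
    \int rho (ln rho + Phi) under the integral sign, locally uniformly on
    ]0, +oo[; [fp_decay] makes the boundary terms vanish when the equation is
    tested against 1, Phi and ln rho. *)
Record fp_regular rho : Prop := FPRegular {
  fp_pos : forall t u, 0 < t -> 0 < rho t u ;
  fp_C2 : forall t, 0 < t -> C2 (rho t) ;
  fp_dt : forall t u, 0 < t -> derivable (rho ^~ u) t 1 ;
  fp_dom : forall a b, 0 < a -> a <= b ->
    exists2 g : 'rV[R]_d -> R, mu.-integrable setT (EFin \o g) &
      forall t u, a <= t <= b ->
        `|'D_1 (rho ^~ u) t| * (1 + `|Phi u| + `|ln (rho t u)|) <= g u ;
  fp_decay : forall t, 0 < t -> mu.-integrable setT (fun u =>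
    (enorm (fp_flux (rho t) u) * (1 + `|Phi u| + `|ln (rho t u)|))%:E)
}.

(** The initial value is attained in L^1 and in relative entropy. *)
Record fp_solution (rho0 : 'rV[R]_d -> R) rho : Prop := FPSolution {
  fp_init : rho 0 = rho0 ;
  fp_density : forall t, 0 <= t -> density2 (rho t) ;
  fp_reg : fp_regular rho ;
  fp_init_L1 : L1dist (rho t) rho0 @[t --> 0^'+] --> 0%E ;
  fp_init_KL : KL (rho t) (gibbs Phi) @[t --> 0^'+] --> KL rho0 (gibbs Phi) ;
  fp_eq : forall t u, 0 < t ->
    'D_1 (rho ^~ u) t = divergence (fp_flux (rho t)) u
}.

End fokker_planck.

(* Main.v *)
Require Import Defs.
From HB Require Import structures.
From mathcomp Require Import all_boot all_order all_algebra.
From mathcomp Require Import all_classical all_reals all_analysis.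
From mathcomp Require Import measurable_realfun ring lra.

(** The relative entropy [H(t) = KL (rho t) (gibbs Phi)] of a solution decreases
    at the rate [D(t) = \int rho <grad h, C(rho) grad h>], where
    [h = ln rho + Phi].  The lower bound [alpha] on the covariance makes [D] at
    least [alpha] times the relative Fisher information [\int rho |grad h|^2], and
    strong convexity of [Phi] makes the latter at least [2 * lambda * H], by the
    logarithmic Sobolev inequality of Bakry and Emery.  Hence
    [H' <= - 2 * alpha * lambda * H], the entropy decays like
    [exp (- 2 * alpha * lambda * t)], and its square root controls the L^1 distance.

    The logarithmic Sobolev inequality is first proved on a cube
    ([cube_logsobolev]), by mass transport.  If a map [T] carries a density [F] to
    a density [G = exp (- Phi)], the Jacobian equation and convexity give
    [ln (F / G) <= - <grad Phi, theta> - lam / 2 * |theta|^2 + div theta] with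
    [theta = T - id]; integrating against [F], an integration by parts and the
    completion of a square conclude.  The map is the Knothe rearrangement, which
    transports one coordinate after the other.  Since the Jacobian of a triangular
    map is the product of its diagonal entries, the whole argument becomes an
    induction on the dimension in which only the monotone transport of
    one-dimensional marginals occurs ([transport_segment]).  On a cube, where the
    marginals are continuous, the displacement of each coordinate vanishes at both
    ends, so that the integration by parts has no boundary term.  The inequality in
    the whole space follows when the cube grows, the masses of the two restricted
    densities tending to one.

    On the side of the dissipation, [cube_dissipation] tests the equation with [h]
    times a polynomial cutoff that vanishes on the faces of a cube; the decay of
    the flux removes the error terms.  It bounds the Fisher information on every
    cube by [D / alpha], and [entropy_le_production] combines this with the
    logarithmic Sobolev inequality on the same cube: the entropy at each positive
    time is finite and [2 * alpha * lambda * H <= D].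

    Differentiation of [H] under the integral sign and a Gronwall argument started
    at time [0^+] give [H(t) <= KL rho0 (gibbs Phi) * exp (- 2 * alpha * lambda * t)].
    Finally [dist_le_entropy] is a form of the Csiszar-Kullback-Pinsker inequality
    with a free parameter [eps], derived from the comparison of entropy and
    Hellinger distance; the choice [eps = exp (- alpha * lambda * t)] yields the
    constant [2 + |KL rho0 (gibbs Phi)|], which is independent of [alpha], [lambda]
    and the solution. *)

Set Implicit Arguments.
Unset Strict Implicit.
Unset Printing Implicit Defensive.

Import Order.TTheory GRing.Theory Num.Theory.
Import numFieldNormedType.Exports.

Local Open Scope classical_set_scope.
Local Open Scope ring_scope.

(** * Topology and measurability of the space of row vectors *)

Section rV_topology.
Context {R : realType}.
Local Notation mu := (@lebesgue_rV R).

Lemma continuous_rV (T : topologicalType) n (f : T -> 'rV[R]_n) :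
  (forall i, continuous (fun x => f x ord0 i)) -> continuous f.
Proof.
move=> cf x; apply/(@cvg_mx_entourageP R 1 n) => A entA.
apply: filter_forall => i; apply: filter_forall => j; rewrite (ord1 i).
have /cvg_app_entourageP/(_ _ entA) := cf j x.
by apply: filterS => y h; apply/mem_set.
Qed.

Lemma rV_consS n x (v : 'rV[R]_n) i :
  rV_cons (x, v) ord0 (lift ord0 i) = v ord0 i.
Proof.
rewrite (_ : lift ord0 i = rshift 1 i); last exact/val_inj.
exact: (row_mxEr _ _ _ _).
Qed.

Lemma continuous_rV_cons_head n (v : 'rV[R]_n) :
  continuous (fun x : R => rV_cons (x, v)).
Proof.
apply: continuous_rV => i; have [j ->|->] := unliftP ord0 i.
  by under eq_fun do rewrite rV_consS; exact: cst_continuous.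
by under eq_fun do rewrite rV_cons0; move=> ?; exact: cvg_id.
Qed.

Lemma continuous_rV_cons_tail n (x : R) :
  continuous (fun v : 'rV[R]_n => rV_cons (x, v)).
Proof.
apply: continuous_rV => i; have [j ->|->] := unliftP ord0 i.
  by under eq_fun do rewrite rV_consS; exact: coord_continuous.
by under eq_fun do rewrite rV_cons0; exact: cst_continuous.
Qed.

Lemma rV_ballE n (u v : 'rV[R]_n) e : 0 < e ->
  (forall i, `|u ord0 i - v ord0 i| < e) -> ball u e v.
Proof. by move=> e0 uv; split => // i j; rewrite !ord1; exact: uv. Qed.

(** The measurable sets are generated by the coordinates, so the point is that an
    open set is a countable union of boxes: the rational ones that it contains. *)
Lemma open_measurable_rV n (U : set 'rV[R]_n) : open U -> measurable U.
Proof.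
move=> oU.
pose box (qk : 'rV[rat]_n * nat) : set 'rV[R]_n :=
  [set v | forall i, `|ratr (qk.1 ord0 i) - v ord0 i| < qk.2.+1%:R^-1].
have mbox qk : measurable (box qk).
  rewrite (_ : box _ = \bigcap_(i in [set: 'I_n]) ((fun v : 'rV[R]_n => v ord0 i)
      @^-1` [set x : R | `|ratr (qk.1 ord0 i) - x| < qk.2.+1%:R^-1])); last first.
    by apply/seteqP; split => v /= h i; [move=> _; exact: h|exact: h].
  apply: fin_bigcap_measurable => [|i _]; first exact: finite_finset.
  rewrite -[X in measurable X]setTI; apply: (measurable_coord i) => //.
  exact: open_measurable (ball_open _ _).
rewrite (_ : U = \bigcup_(qk : 'rV[rat]_n * nat)
    (if `[< box qk `<=` U >] then box qk else set0)); last first.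
  apply/seteqP; split => [u Uu|u [qk _]]; last by case: asboolP => // + /= => /[apply].
  have /nbhs_ballP[e /= e0 eU] : nbhs u U by exact: open_nbhs_nbhs.
  have [k ke] : exists k : nat, k.+1%:R^-1 < e / 2.
    have e20 : 0 < e / 2 by rewrite divr_gt0.
    near \oo => k; exists k.
    by near: k; exact: (near_infty_natSinv_lt (PosNum e20)).
  have kp : 0 < k.+1%:R^-1 :> R by rewrite invr_gt0.
  have /choice[q qu] : forall i, exists q : rat,
      ratr q \in `]u ord0 i - k.+1%:R^-1, u ord0 i + k.+1%:R^-1[.
    move=> i; apply: rat_in_itvoo.
    by rewrite ltrD2l (lt_trans _ kp)// oppr_lt0.
  have bu : box (\row_i q i, k) u.
    move=> i /=; rewrite mxE ltr_distl.
    by have := qu i; rewrite in_itv.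
  exists (\row_i q i, k) => //; case: asboolP => // -[] v bv; apply: eU.
  apply: rV_ballE => // i.
  have := bv i; have := bu i => /= h1 h2.
  have := ler_distD (ratr ((\row_i q i) ord0 i)) (u ord0 i) (v ord0 i).
  rewrite (distrC (u ord0 i) (ratr _)) => h3.
  apply: le_lt_trans h3 _; apply: lt_trans (ltrD h1 h2) _.
  by rewrite (splitr e) ltrD.
apply: countable_bigcupT_measurable => // qk; case: ifP => // _.
Unshelve. all: by end_near. Qed.

Lemma continuous_measurable_rV n (f : 'rV[R]_n -> R) :
  continuous f -> measurable_fun setT f.
Proof.
move=> /continuousP cf; apply: (measurability _ (RGenOpens.measurableE R)).
move=> _ [_ [a [b ->] <-]]; rewrite setTI.
by apply: open_measurable_rV; apply: cf; exact: interval_open.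
Qed.

Definition cube (r : R) (n : nat) : set 'rV[R]_n :=
  [set v | forall i, v ord0 i \in `[- r, r]].
Arguments cube r n : clear implicits.

Lemma measurable_cube r n : measurable (cube r n).
Proof.
rewrite (_ : cube r n = \bigcap_(i in [set: 'I_n]) ((fun v : 'rV[R]_n => v ord0 i)
      @^-1` `[- r, r])); last first.
  by apply/seteqP; split => v /= h i; [move=> _; exact: h|exact: h].
apply: fin_bigcap_measurable => [|i _]; first exact: finite_finset.
by rewrite -[X in measurable X]setTI; apply: (measurable_coord i).
Qed.

Lemma compact_cube r n : compact (cube r n).
Proof. by apply: (@rV_compact _ _ (fun=> `[- r, r]%classic)) => _; exact: segment_compact. Qed.

Lemma cube_finite r n : (mu n (cube r n) < +oo)%E.
Proof.
rewrite (@lebesgue_rV_box R n (fun=> `[- r, r]%classic)) //.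
pose I := [set` `[- r, r]] : set (measurableTypeR R).
suff /andP[] : (0 <= \prod_(i < n) lebesgue_measure I < +oo)%E by [].
elim/big_ind : _ => [|x y /andP[x0 xoo] /andP[y0 yoo]|i _].
- by rewrite lee_fin ler01 ltry.
- by rewrite mule_ge0//= lte_mul_pinfty// ge0_fin_numE.
- by rewrite measure_ge0 lebesgue_measure_itv/=; case: ifP => _; rewrite ?ltry.
Qed.

Lemma cube_cons r n x (v : 'rV[R]_n) :
  cube r n.+1 (rV_cons (x, v)) <-> x \in `[- r, r] /\ cube r n v.
Proof.
split=> [h|[h1 h2] i].
  by split=> [|i]; [have := h ord0; rewrite rV_cons0|
    have := h (lift ord0 i); rewrite rV_consS].
by have [j ->|->] := unliftP ord0 i; rewrite ?rV_cons0 ?rV_consS.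
Qed.

Lemma cube_bounded r n (f : 'rV[R]_n -> R) : continuous f ->
  exists2 M : R, 0 < M & forall v, cube r n v -> `|f v| <= M.
Proof.
move=> cf.
have : compact (f @` cube r n).
  apply: continuous_compact; first exact: continuous_subspaceT.
  exact: compact_cube.
move=> /(@compact_bounded R R^o)[M [_ hM]].
exists (`|M| + 1) => [|v vQ]; first by rewrite ltr_pwDr.
by apply: (hM (`|M| + 1)); [rewrite (le_lt_trans (ler_norm M))// ltrDl|exists v].
Qed.

Lemma integrable_cube r n (f : 'rV[R]_n -> R) : continuous f ->
  (mu n).-integrable (cube r n) (EFin \o f).
Proof.
move=> cf; have [M M0 fM] := cube_bounded r cf.
apply: measurable_bounded_integrable => //.
- exact: measurable_cube.
- exact: cube_finite.
- exact: measurable_funTS (continuous_measurable_rV cf).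
- exists M; split; rewrite ?num_real// => K MK v vQ.
  exact: le_trans (fM _ vQ) (ltW MK).
Qed.
End rV_topology.
Arguments cube {R} r n.
Arguments measurable_cube {R} r n.
Arguments compact_cube {R} r n.
Arguments cube_finite {R} r n.

(** * Fubini on cubes *)

Section cube_fubini.
Context {R : realType}.
Local Notation mu := (@lebesgue_rV R).
Local Notation leb := (@lebesgue_measure R).

Lemma preimage_cube r n : @rV_cons R n @^-1` cube r n.+1 =
  [set` `[- r, r]] `*` cube r n.
Proof. by apply/seteqP; split => -[x v] /cube_cons. Qed.

Lemma continuous_slice_head n (f : 'rV[R]_n.+1 -> R) v :
  continuous f -> continuous (fun x : R => f (rV_cons (x, v))).
Proof. by move=> cf x; apply: continuous_comp; [exact: continuous_rV_cons_head|exact: cf]. Qed.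

Lemma continuous_slice_tail n (f : 'rV[R]_n.+1 -> R) x :
  continuous f -> continuous (fun v : 'rV[R]_n => f (rV_cons (x, v))).
Proof. by move=> cf v; apply: continuous_comp; [exact: continuous_rV_cons_tail|exact: cf]. Qed.

Section fubini.
Variables (r : R) (n : nat) (f : 'rV[R]_n.+1 -> R).
Hypothesis cf : continuous f.
Let Q := [set` `[- r, r]] `*` cube r n.
Let I := [set` `[- r, r]] : set (measurableTypeR R).
Let g : measurableTypeR R * 'rV[R]_n -> \bar R :=
  (fun p => (f (rV_cons p))%:E) \_ Q.

Let mQ : measurable Q.
Proof. by apply: measurableX => //; exact: measurable_cube. Qed.

Let int_cons : (leb \x mu n)%E.-integrable Q (fun p => (f (rV_cons p))%:E).
Proof.
have [M M0 fM] := cube_bounded r cf.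
apply: measurable_bounded_integrable => //.
- have := @cube_finite R r n.+1.
  by rewrite /= /lebesgue_rV_step /pushforward preimage_cube.
- apply: measurable_funTS; apply: measurableT_comp; last exact: measurable_rV_cons.
  exact: continuous_measurable_rV cf.
- exists M; split; rewrite ?num_real// => K MK p.
  by rewrite /Q -preimage_cube => pQ; apply: le_trans (fM _ pQ) (ltW MK).
Qed.

Let int_g : (leb \x mu n)%E.-integrable setT g.
Proof. by move/integrable_mkcond : int_cons; exact. Qed.

Let pushE : (\int[mu n.+1]_(u in cube r n.+1) (f u)%:E =
  \int[(leb \x mu n)%E]_p g p)%E.
Proof.
rewrite /g -integral_mkcond /Q -preimage_cube.
rewrite -(@integral_pushforward _ _ _ _ _ (@rV_cons R n) _ (leb \x mu n)%E _ (EFin \o f)) //.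
- exact: measurable_rV_cons.
- by apply/measurable_EFinP; exact: continuous_measurable_rV.
- by rewrite preimage_cube.
- exact: measurable_cube.
Qed.

Let slicel x : (\int[mu n]_v g (x, v) =
  ((fun x => (\int[mu n]_(v in cube r n) f (rV_cons (x, v)))%:E) \_ I) x)%E.
Proof.
rewrite /g /patch; case: ifPn => xI; last first.
  rewrite integral0_eq// => v _; case: ifPn => // /set_mem[/= xI'].
  by move: xI; rewrite notin_setE.
rewrite /Rintegral fineK; last first.
  by apply: integrable_fin_num; [exact: measurable_cube|exact/integrable_cube/continuous_slice_tail].
rewrite [RHS]integral_mkcond /patch; apply: eq_integral => v _.
by rewrite in_setX/= xI.
Qed.

Let slicer v : (\int[leb]_x g (x, v) =
  ((fun v => (\int[leb]_(x in `[- r, r]) f (rV_cons (x, v)))%:E) \_ (cube r n)) v)%E.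
Proof.
rewrite /g /patch; case: ifPn => vI; last first.
  rewrite integral0_eq// => x _; case: ifPn => // /set_mem[/= _ vI'].
  by move: vI; rewrite notin_setE.
rewrite /Rintegral fineK; last first.
  apply: integrable_fin_num => //; apply: continuous_compact_integrable.
    exact: segment_compact.
  by apply: continuous_subspaceT; exact: continuous_slice_head.
rewrite [RHS]integral_mkcond /patch; apply: eq_integral => x _.
by rewrite in_setX/= vI andbT.
Qed.

Lemma cube_fubini1 : \int[mu n.+1]_(u in cube r n.+1) f u =
  \int[leb]_(x in `[- r, r]) \int[mu n]_(v in cube r n) f (rV_cons (x, v)).
Proof.
rewrite [LHS]/Rintegral pushE -integral12_prod_meas1//; congr fine.
rewrite [RHS]integral_mkcond; apply: eq_integral => x _.
by rewrite /fubini_F slicel.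
Qed.

Lemma cube_fubini2 : \int[mu n.+1]_(u in cube r n.+1) f u =
  \int[mu n]_(v in cube r n) \int[leb]_(x in `[- r, r]) f (rV_cons (x, v)).
Proof.
rewrite [LHS]/Rintegral pushE -integral21_prod_meas1//; congr fine.
rewrite [RHS]integral_mkcond; apply: eq_integral => x _.
by rewrite /fubini_G slicer.
Qed.

End fubini.

(** Dominated convergence: near a given abscissa the slices of [f] are bounded by
    the maximum of [f] on a larger cube. *)
Lemma continuous_marginal r n (f : 'rV[R]_n.+1 -> R) : 0 <= r -> continuous f ->
  continuous (fun x : R => \int[mu n]_(v in cube r n) f (rV_cons (x, v))).
Proof.
move=> r0 cf x.
pose s := `|x| + r + 1.
have rs : r <= s by have := normr_ge0 x; rewrite /s; lra.
have [M M0 fM] := cube_bounded s cf.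
have /(_ x) : {in `]- s, s[%classic, continuous
    (fun x : R => \int[mu n]_(v in cube r n) f (rV_cons (x, v)))}.
  apply: (@continuity_under_integral _ _ _ (mu n) (fun x v => f (rV_cons (x, v)))
    _ (measurable_cube r n) (- s) s _ _ (cst M)).
  - by move=> y _; exact/integrable_cube/continuous_slice_tail.
  - by apply: aeW => v _ y _; exact: continuous_slice_head.
  - by apply: integrable_cube; exact: cst_continuous.
  - move=> y ys; apply: aeW => v vQ; apply: fM; apply/cube_cons; split.
      exact: subset_itv_oo_cc.
    move=> i; have := vQ i; rewrite !in_itv/= => /andP[h1 h2].
    by rewrite (le_trans _ h1) ?lerN2// (le_trans h2).
apply; rewrite inE/= in_itv/= -ltr_norml /s.
by lra.
Qed.

End cube_fubini.

(** * Monotone transport on a segment *)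

Section one_dim.
Context {R : realType}.
Local Notation leb := (@lebesgue_measure R).

Lemma integrable_segment (a b : R) (f : R -> R) : continuous f ->
  leb.-integrable `[a, b] (EFin \o f).
Proof.
move=> cf; apply: continuous_compact_integrable; first exact: segment_compact.
exact: continuous_subspaceT.
Qed.

(** One antiderivative serves a whole half line, so that a segment can be placed in
    its interior and derivatives at the ends of the segment make sense. *)
Lemma antiderivative (f : R -> R) (a : R) : continuous f ->
  exists F : R -> R, forall x, a < x -> is_derive x 1 F (f x).
Proof.
move=> cf; exists (fun x => \int[leb]_(t in `[a, x]) f t) => x ax.
have xx1 : x < x + 1 by rewrite ltrDl.
have [dF Fx] := @continuous_FTC1_closed R f a x (x + 1) xx1
  (integrable_segment _ _ cf) ax (cf x).
by apply: (DeriveDef dF); rewrite -derive1E.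
Qed.

Lemma segment_FTC (a b : R) (F f : R -> R) : a < b -> continuous F -> continuous f ->
  (forall x, x \in `]a, b[ -> is_derive x 1 F (f x)) ->
  \int[leb]_(x in `[a, b]) f x = F b - F a.
Proof.
move=> ab cF cf dF; rewrite /Rintegral (@continuous_FTC2 R f F)//.
- exact: continuous_subspaceT.
- split; first by move=> x xab; have [] := dF _ xab.
    exact: cvg_at_right_filter (cF a).
  exact: cvg_at_left_filter (cF b).
- by move=> x xab; rewrite derive1E; have [_ ->] := dF _ xab.
Qed.

Lemma is_derive_continuous (f : R -> R) (x l : R) :
  is_derive x 1 f l -> {for x, continuous f}.
Proof. by move=> [df _]; apply/differentiable_continuous/derivable1_diffP. Qed.

Lemma increment_bounds (F f : R -> R) (a b c C x y : R) :
  (forall x, x \in `[a, b] -> is_derive x 1 F (f x)) ->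
  (forall x, x \in `[a, b] -> c <= f x <= C) ->
  x \in `[a, b] -> y \in `[a, b] -> x <= y ->
  c * (y - x) <= F y - F x <= C * (y - x).
Proof.
move=> dF fcC; rewrite !in_itv/= => /andP[ax xb] /andP[ay yb] xy.
have sub z : z \in `[x, y] -> z \in `[a, b].
  rewrite !in_itv/= => /andP[xz zy].
  by rewrite (le_trans ax xz) (le_trans zy yb).
have dF' z : z \in `]x, y[ -> is_derive z 1 F (f z).
  by move=> zxy; apply/dF/sub/subset_itv_oo_cc.
have cF : {within `[x, y], continuous F}.
  apply: derivable_within_continuous => z zxy.
  by have [] := dF z (sub _ zxy).
have [z zxy ->] := MVT_segment xy dF' cF.
have /andP[h1 h2] := fcC _ (sub _ zxy).
by rewrite !ler_wpM2r// subr_ge0.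
Qed.

Lemma clamp_lipschitz (a b x y : R) : x <= y ->
  let clamp z := Num.max a (Num.min z b) in clamp x <= clamp y <= clamp x + (y - x).
Proof.
move=> xy /=; case: (leP x b) => ?; case: (leP y b) => ?.
- by case: (leP a x) => ?; case: (leP a y) => ?; apply/andP; split; lra.
- by case: (leP a x) => ?; case: (leP a b) => ?; apply/andP; split; lra.
- lra.
- by rewrite lexx lerDl subr_ge0.
Qed.

(** Monotone rearrangement: [T x] is the point at which the distribution function of
    [g] takes the value which that of [f] takes at [x].  Both distribution functions
    are strictly increasing and C^1, hence so is [T].  It is extended to the whole
    line by constants, to be continuous everywhere. *)
Lemma transport_segment (r : R) (f g : R -> R) : 0 < r ->
  continuous f -> continuous g -> (forall x, 0 < f x) -> (forall x, 0 < g x) ->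
  let mf := \int[leb]_(x in `[- r, r]) f x in
  let mg := \int[leb]_(x in `[- r, r]) g x in
  exists T T' : R -> R, [/\ continuous T, continuous T', T (- r) = - r /\ T r = r,
      (forall x, x \in `]- r, r[ -> is_derive x 1 T (T' x)) &
      forall x, x \in `[- r, r] -> T x \in `[- r, r] /\
        T' x = (f x / mf) * (mg / g (T x))].
Proof.
move=> r0 cf cg f0 g0 mf mg.
have rr : - r < r by rewrite gtrN.
have [F dF] := @antiderivative f (- r - 1) cf.
have [G dG] := @antiderivative g (- r - 1) cg.
have inI x : - r <= x -> - r - 1 < x by move=> h; rewrite ltrBlDr ltr_pwDr.
have [mI pI] : - r \in `[- r, r] /\ r \in `[- r, r].
  by rewrite !in_itv/= !lexx !(ltW rr).
have rangeI (h : R -> R) : continuous h -> (forall x, 0 < h x) -> exists c C : R,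
    [/\ 0 < c, 0 < C & forall x, x \in `[- r, r] -> c <= h x <= C].
  move=> ch h0.
  have [c cI hc] := @EVT_min R h (- r) r (ltW rr) (continuous_subspaceT ch).
  have [d dI hd] := @EVT_max R h (- r) r (ltW rr) (continuous_subspaceT ch).
  by exists (h c), (h d); split=> // x xI; rewrite hc// hd.
have FTC (h H : R -> R) : continuous h -> (forall x, - r - 1 < x -> is_derive x 1 H (h x)) ->
    \int[leb]_(x in `[- r, r]) h x = H r - H (- r).
  move=> ch dH; have dH' x : x \in `[- r, r] -> is_derive x 1 H (h x).
    by rewrite in_itv/= => /andP[/inI xr _]; exact: dH.
  rewrite /Rintegral (@continuous_FTC2 R h H)//.
  - exact: continuous_subspaceT.
  - split.
    + by move=> x /subset_itv_oo_cc xab; have [] := dH' _ xab.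
    + exact: cvg_at_right_filter (is_derive_continuous (dH' _ mI)).
    + exact: cvg_at_left_filter (is_derive_continuous (dH' _ pI)).
  - by move=> x /subset_itv_oo_cc xab; rewrite derive1E; have [_ ->] := dH' _ xab.
have [c [C [c0 C0 fcC]]] := rangeI _ cf f0.
have [k [K [k0 K0 gkK]]] := rangeI _ cg g0.
have dF' x : x \in `[- r, r] -> is_derive x 1 F (f x).
  by rewrite in_itv/= => /andP[/inI xr _]; exact: dF.
have dG' x : x \in `[- r, r] -> is_derive x 1 G (g x).
  by rewrite in_itv/= => /andP[/inI xr _]; exact: dG.
have Fb := increment_bounds dF' fcC.
have Gb := increment_bounds dG' gkK.
have mfE : mf = F r - F (- r) by exact: FTC.
have mgE : mg = G r - G (- r) by exact: FTC.
have mf0 : 0 < mf.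
  have /andP[+ _] := Fb _ _ mI pI (ltW rr); rewrite -mfE; apply: lt_le_trans.
  by rewrite mulr_gt0// subr_gt0.
have mg0 : 0 < mg.
  have /andP[+ _] := Gb _ _ mI pI (ltW rr); rewrite -mgE; apply: lt_le_trans.
  by rewrite mulr_gt0// subr_gt0.
(* [T] solves [G (T x) = A x], where [A] is the primitive of [f] rescaled so that
   its values at the ends of the segment are those of [G] *)
pose A x := G (- r) + (F x - F (- r)) * (mg / mf).
have q0 : 0 < mg / mf by rewrite divr_gt0.
have Fle x y : x \in `[- r, r] -> y \in `[- r, r] -> x <= y -> F x <= F y.
  move=> xI yI xy; have /andP[+ _] := Fb _ _ xI yI xy.
  by rewrite -[F x <= _]subr_ge0; apply: le_trans; rewrite mulr_ge0 ?subr_ge0// ltW.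
have Glt x y : x \in `[- r, r] -> y \in `[- r, r] -> x < y -> G x < G y.
  move=> xI yI xy; have /andP[+ _] := Gb _ _ xI yI (ltW xy).
  by rewrite -[G x < _]subr_gt0; apply: lt_le_trans; rewrite mulr_gt0 ?subr_gt0.
have Ar : A r = G r by rewrite /A -mfE mulrC divfK ?gt_eqF// mgE addrC subrK.
have Amr : A (- r) = G (- r) by rewrite /A subrr mul0r addr0.
have cG : {within `[- r, r], continuous G}.
  by apply: derivable_within_continuous => x /dG'[].
have /choice[T0 hT0] : forall x, exists y, x \in `[- r, r] -> y \in `[- r, r] /\ G y = A x.
  move=> x; have [xI|] := boolP (x \in `[- r, r]); last by exists 0.
  have [|y yI Gy] := @IVT R G (- r) r (A x) (ltW rr) cG; last by exists y.
  have Ax1 : G (- r) <= A x.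
    by rewrite -Amr lerD2l ler_pM2r// lerD2r Fle//; move: xI; rewrite in_itv/= => /andP[].
  have Ax2 : A x <= G r.
    by rewrite -Ar lerD2l ler_pM2r// lerD2r Fle//; move: xI; rewrite in_itv/= => /andP[].
  by rewrite ge_min le_max Ax1 Ax2 orbT.
have Ginj x y : x \in `[- r, r] -> y \in `[- r, r] -> G x = G y -> x = y.
  move=> xI yI; case: (ltgtP x y) => // xy Gxy.
    by have := Glt _ _ xI yI xy; rewrite Gxy ltxx.
  by have := Glt _ _ yI xI xy; rewrite Gxy ltxx.
pose clamp x := Num.max (- r) (Num.min x r).
have clampI x : clamp x \in `[- r, r].
  by rewrite in_itv/= /clamp le_max lexx/= ge_max ge_min lexx orbT !(ltW rr).
have clampK x : x \in `[- r, r] -> clamp x = x.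
  rewrite in_itv/= => /andP[h1 h2]; rewrite /clamp (min_idPl h2).
  exact: (max_idPr h1).
pose T x := T0 (clamp x).
have TI x : T x \in `[- r, r] by have [] := hT0 _ (clampI x).
have GT x : G (T x) = A (clamp x) by have [] := hT0 _ (clampI x).
have clamp_mono x y : x <= y -> clamp x <= clamp y <= clamp x + (y - x).
  exact: clamp_lipschitz.
set L := C * (mg / mf) / k.
have L0 : 0 < L by rewrite divr_gt0// mulr_gt0.
have Tmon x y : x <= y -> `|T y - T x| <= L * (y - x).
  move=> /clamp_mono/andP[c1 c2].
  have /andP[_ hF] := Fb _ _ (clampI x) (clampI y) c1.
  have hF0 := Fle _ _ (clampI x) (clampI y) c1.
  have GTT : G (T y) - G (T x) = (F (clamp y) - F (clamp x)) * (mg / mf).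
    by rewrite !GT /A; ring.
  have Txy : T x <= T y.
    rewrite leNgt; apply/negP => /(Glt _ _ (TI y) (TI x)).
    by rewrite -subr_lt0 GTT pmulr_llt0// subr_lt0 ltNge hF0.
  have /andP[hG _] := Gb _ _ (TI x) (TI y) Txy.
  rewrite ger0_norm ?subr_ge0// /L mulrAC ler_pdivlMr// mulrC (le_trans hG)//.
  rewrite GTT [leRHS]mulrAC ler_pM2r// (le_trans hF)// ler_pM2l//.
  by rewrite lerBlDl.
(* the lower bound on [g] makes [T] Lipschitz *)
have cT : continuous T.
  move=> x; apply/cvgrPdist_le => e e0; near=> y.
  have Txy : `|T x - T y| <= L * `|x - y|.
    have [xy|/ltW yx] := leP x y.
      by rewrite distrC (distrC x) (ger0_norm (x := y - x)) ?subr_ge0// Tmon.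
    by rewrite (ger0_norm (x := x - y)) ?subr_ge0// Tmon.
  rewrite (le_trans Txy)// mulrC -ler_pdivlMr//; near: y.
  exists (e / L); first exact: divr_gt0.
  by move=> z; exact: ltW.
have Tr : T r = r by apply: Ginj => //; rewrite GT clampK.
have Tmr : T (- r) = - r by apply: Ginj => //; rewrite GT clampK.
exists T, (fun x => (f x / mf) * (mg / g (T x))); split => //.
- move=> x; apply: cvgM.
    by apply: cvgM; [exact: cf|exact: cvg_cst].
  apply: cvgM; first exact: cvg_cst.
  apply: cvgV; first by rewrite gt_eqF.
  by apply: (continuous_comp (cT x)); exact: cg.
- move=> x xI; have xI' := subset_itv_oo_cc xI.
  have Flt u v : u \in `[- r, r] -> v \in `[- r, r] -> u < v -> F u < F v.
    move=> uI vI uv; have /andP[+ _] := Fb _ _ uI vI (ltW uv).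
    by rewrite -[F u < _]subr_gt0; apply: lt_le_trans; rewrite mulr_gt0 ?subr_gt0.
  have Tx : T x \in `]- r, r[.
    move: (xI); rewrite !in_itv/= => /andP[xr1 xr2].
    have := TI x; rewrite in_itv/= !le_eqVlt => /andP[/predU1P[Tx|->] /predU1P[Tx'|->//]].
    - by move: rr; rewrite Tx Tx' ltxx.
    - have := GT x; rewrite -Tx clampK// -Amr => /addrI/mulIf -/(_ (lt0r_neq0 q0)).
      by move=> /addIr => /eqP; rewrite lt_eqF// Flt.
    - have := GT x; rewrite Tx' clampK// -Ar => /addrI/mulIf -/(_ (lt0r_neq0 q0)).
      by move=> /addIr => /eqP; rewrite gt_eqF// Flt.
  pose Ginv z := xget 0 [set y | y \in `[- r, r] /\ G y = z].
  have GinvK y : y \in `[- r, r] -> Ginv (G y) = y.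
    move=> yI; rewrite /Ginv; case: xgetP => [z _ [zI /Ginj]|/(_ y)[]//]; exact.
  have nearI z : z \in `]- r, r[ -> \forall y \near z, y \in `]- r, r[.
    by move=> zI; exact: near_in_itvoo.
  have dGinv : is_derive (G (T x)) 1 Ginv (g (T x))^-1.
    apply: is_derive_inverse; last by rewrite gt_eqF.
    + by apply: filterS (nearI _ Tx) => y /subset_itv_oo_cc; exact: GinvK.
    + apply: filterS (nearI _ Tx) => y /subset_itv_oo_cc yI.
      exact: is_derive_continuous (dG' _ yI).
    + exact/dG'/subset_itv_oo_cc.
  have dA : is_derive x 1 A (f x * (mg / mf)).
    rewrite (_ : A = cst (G (- r)) + (mg / mf) \*: (F - cst (F (- r)))); last first.
      by apply/funext => y; rewrite /A !fctE/= mulrC.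
    have dFx := dF' _ xI'; apply: is_derive_eq.
    by rewrite add0r subr0; exact: mulrC.
  have AT : A x = G (T x) by rewrite GT clampK.
  rewrite (_ : _ * _ = (g (T x))^-1 * (f x * (mg / mf))); last by ring.
  rewrite -AT in dGinv.
  apply: near_eq_is_derive (is_derive1_comp dGinv dA).
  apply: filterS (nearI _ xI) => y /subset_itv_oo_cc yI /=.
  by rewrite -[A y](_ : G (T y) = A y) ?GinvK// GT clampK.
Unshelve. all: by end_near. Qed.
End one_dim.

(** * Calculus on cubes *)

Section continuity.
Context {R : realType} {T : topologicalType}.
Implicit Types f g : T -> R.

Lemma ctsD f g : continuous f -> continuous g -> continuous (fun x => f x + g x).
Proof. by move=> cf cg x; apply: cvgD; [exact: cf|exact: cg]. Qed.

Lemma ctsB f g : continuous f -> continuous g -> continuous (fun x => f x - g x).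
Proof. by move=> cf cg x; apply: cvgB; [exact: cf|exact: cg]. Qed.

Lemma ctsN f : continuous f -> continuous (fun x => - f x).
Proof. by move=> cf x; apply: cvgN; exact: cf. Qed.

Lemma ctsM f g : continuous f -> continuous g -> continuous (fun x => f x * g x).
Proof. by move=> cf cg x; apply: cvgM; [exact: cf|exact: cg]. Qed.

Lemma ctsX f n : continuous f -> continuous (fun x => f x ^+ n).
Proof.
move=> cf; elim: n => [|n IH]; first exact: cst_continuous.
by under eq_fun do rewrite exprS; exact: ctsM.
Qed.

Lemma ctsV f : continuous f -> (forall x, f x != 0) -> continuous (fun x => (f x)^-1).
Proof. by move=> cf f0 x; apply: cvgV; [exact: f0|exact: cf]. Qed.

Lemma cts_ln f : continuous f -> (forall x, 0 < f x) -> continuous (fun x => ln (f x)).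
Proof. by move=> cf f0 x; apply: continuous_comp; [exact: cf|exact: continuous_ln]. Qed.

Lemma cts_expR f : continuous f -> continuous (fun x => expR (f x)).
Proof. by move=> cf x; apply: continuous_comp; [exact: cf|exact: continuous_expR]. Qed.

Lemma cts_sum (I : Type) (s : seq I) (P : pred I) (F : I -> T -> R) :
  (forall i, continuous (F i)) -> continuous (fun x => \sum_(i <- s | P i) F i x).
Proof. by move=> cF; apply: continuous_big => //; exact: add_continuous. Qed.

Lemma cts_prod (I : Type) (s : seq I) (P : pred I) (F : I -> T -> R) :
  (forall i, continuous (F i)) -> continuous (fun x => \prod_(i <- s | P i) F i x).
Proof. by move=> cF; apply: continuous_big => //; exact: mul_continuous. Qed.
End continuity.

(** Structural proof of continuity for real expressions; the leaves are looked up
    among the hypotheses, and the side conditions on logarithms and inverses too. *)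
Ltac cont :=
  repeat match goal with
  | |- continuous (fun _ => ?c) => exact: cst_continuous
  | |- continuous (fun x => @?f x - @?g x) => apply: (@ctsB _ _ f g)
  | |- continuous (fun x => @?f x + @?g x) => apply: (@ctsD _ _ f g)
  | |- continuous (fun x => - @?f x) => apply: (@ctsN _ _ f)
  | |- continuous (fun x => @?f x * @?g x) => apply: (@ctsM _ _ f g)
  | |- continuous (fun x => (@?f x)^-1) => apply: (@ctsV _ _ f)
  | |- continuous (fun x => @?f x ^+ _) => apply: (@ctsX _ _ f)
  | |- continuous (fun x => ln (@?f x)) => apply: (@cts_ln _ _ f)
  | |- continuous (fun x => expR (@?f x)) => apply: (@cts_expR _ _ f)
  | |- continuous (fun x => \sum_(i <- _ | _) _) => apply: cts_sum => ?
  | |- continuous (fun x => \prod_(i <- _ | _) _) => apply: cts_prod => ?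
  end; try solve [match goal with H : forall _, _ |- _ => simple apply H end | assumption].

Section slices.
Context {R : realType}.
Variables (n : nat) (f : 'rV[R]_n.+1 -> R) (x : R) (v : 'rV[R]_n).

Lemma rV_cons_shift_head h :
  rV_cons (h *: 1 + x, v) = h *: delta_mx ord0 ord0 + rV_cons (x, v).
Proof.
apply/rowP => i; rewrite [RHS]mxE [X in _ = X + _]mxE [X in _ = _ * X + _]mxE.
have [j ->|->] := unliftP ord0 i.
  by rewrite !rV_consS/= mulr0 add0r.
by rewrite !rV_cons0.
Qed.

Lemma rV_cons_shift_tail h j :
  rV_cons (x, h *: delta_mx ord0 j + v) =
  h *: delta_mx ord0 (lift ord0 j) + rV_cons (x, v).
Proof.
apply/rowP => i; rewrite [RHS]mxE [X in _ = X + _]mxE [X in _ = _ * X + _]mxE.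
have [k ->|->] := unliftP ord0 i.
  by rewrite !rV_consS !mxE eqxx/= (inj_eq lift_inj).
by rewrite !rV_cons0/= mulr0 add0r.
Qed.

Lemma is_derive_slice_head D :
  is_derive (rV_cons (x, v)) (delta_mx ord0 ord0) f D ->
  is_derive x 1 (fun y => f (rV_cons (y, v))) D.
Proof.
move=> [df <-]; have E : (fun h : R => h^-1 *: ((f \o shift (rV_cons (x, v)))
    (h *: delta_mx ord0 ord0) - f (rV_cons (x, v)))) =
  (fun h => h^-1 *: (((fun y => f (rV_cons (y, v))) \o shift x) (h *: 1) -
    f (rV_cons (x, v)))).
  by apply/funext => h /=; rewrite rV_cons_shift_head.
by move: df; rewrite /derivable /derive E => df; apply: (DeriveDef df).
Qed.

Lemma is_derive_slice_tail j D :
  is_derive (rV_cons (x, v)) (delta_mx ord0 (lift ord0 j)) f D ->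
  is_derive v (delta_mx ord0 j) (fun w => f (rV_cons (x, w))) D.
Proof.
move=> [df <-]; have E : (fun h : R => h^-1 *: ((f \o shift (rV_cons (x, v)))
    (h *: delta_mx ord0 (lift ord0 j)) - f (rV_cons (x, v)))) =
  (fun h => h^-1 *: (((fun w => f (rV_cons (x, w))) \o shift v) (h *: delta_mx ord0 j) -
    f (rV_cons (x, v)))).
  by apply/funext => h /=; rewrite rV_cons_shift_tail.
by move: df; rewrite /derivable /derive E => df; apply: (DeriveDef df).
Qed.
End slices.

Section cube_calculus.
Context {R : realType}.
Local Notation mu := (@lebesgue_rV R).
Local Notation leb := (@lebesgue_measure R).

Lemma cube_intB (r : R) n (f g : 'rV[R]_n -> R) : continuous f -> continuous g ->
  \int[mu n]_(v in cube r n) (f v - g v) =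
  \int[mu n]_(v in cube r n) f v - \int[mu n]_(v in cube r n) g v.
Proof. by move=> cf cg; apply: RintegralB; [exact: measurable_cube|exact: integrable_cube..]. Qed.

Lemma cube_intD (r : R) n (f g : 'rV[R]_n -> R) : continuous f -> continuous g ->
  \int[mu n]_(v in cube r n) (f v + g v) =
  \int[mu n]_(v in cube r n) f v + \int[mu n]_(v in cube r n) g v.
Proof. by move=> cf cg; apply: RintegralD; [exact: measurable_cube|exact: integrable_cube..]. Qed.

Lemma cube_intZ (r : R) n (f : 'rV[R]_n -> R) c : continuous f ->
  \int[mu n]_(v in cube r n) (c * f v) = c * \int[mu n]_(v in cube r n) f v.
Proof. by move=> cf; apply: RintegralZl; [exact: measurable_cube|exact: integrable_cube]. Qed.

Lemma cube_int_le (r : R) n (f g : 'rV[R]_n -> R) : continuous f -> continuous g ->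
  (forall v, cube r n v -> f v <= g v) ->
  \int[mu n]_(v in cube r n) f v <= \int[mu n]_(v in cube r n) g v.
Proof. by move=> cf cg; apply: le_Rintegral; [exact: measurable_cube|exact: integrable_cube..]. Qed.

Lemma cube_int_dim0 (r : R) (f : 'rV[R]_0 -> R) : \int[mu 0]_(v in cube r 0) f v = f 0.
Proof.
rewrite /Rintegral (_ : cube r 0 = setT); last by apply/seteqP; split => // v _ [].
rewrite /= integral_dirac//=; first by rewrite indicT mul1r.
apply/measurable_EFinP; rewrite (_ : f = cst (f 0))//.
by apply/funext => w; rewrite /= [w]thinmx0.
Qed.

Lemma cube_int_gt0 (r : R) n (f : 'rV[R]_n -> R) : 0 < r -> continuous f ->
  (forall v, 0 < f v) -> 0 < \int[mu n]_(v in cube r n) f v.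
Proof.
move=> r0; elim: n f => [|n IH] f cf f0; first by rewrite cube_int_dim0.
rewrite cube_fubini1//.
pose m (x : R) := \int[mu n]_(v in cube r n) f (rV_cons (x, v)).
change (0 < \int[leb]_(x in `[- r, r]) m x).
have cm : continuous m by apply: continuous_marginal; rewrite ?ltW.
have m0 x : 0 < m x by apply: IH => //; exact: continuous_slice_tail.
have rr : - r <= r by rewrite ge0_cp ?ltW.
have [c cI hc] := @EVT_min R m (- r) r rr (continuous_subspaceT cm).
apply: (@lt_le_trans _ _ (\int[leb]_(x in `[- r, r]) m c)).
  rewrite Rintegral_cst//=; rewrite lebesgue_measure_itv/= lte_fin gtrN//.
  by rewrite mulr_gt0//= subr_gt0 gtrN.
apply: le_Rintegral => //; [|exact: integrable_segment].
by apply: integrable_segment; exact: cst_continuous.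
Qed.

(** Fubini reduces the statement to the one-dimensional fundamental theorem in
    the direction of differentiation. *)
Lemma cube_int_partial (r : R) n (i : 'I_n) (f Df : 'rV[R]_n -> R) : 0 < r ->
  continuous f -> continuous Df ->
  (forall u : 'rV[R]_n, is_derive u (delta_mx ord0 i) f (Df u)) ->
  (forall u : 'rV[R]_n, `|u ord0 i| = r -> f u = 0) ->
  \int[mu n]_(u in cube r n) Df u = 0.
Proof.
move=> r0; elim: n i f Df => [[]//|n IH] i f Df cf cDf dDf f0.
have nr : `|r| = r by rewrite ger0_norm ?ltW.
move: dDf f0; have [j ->|->] := unliftP ord0 i => dDf f0.
  rewrite cube_fubini1// /Rintegral integral0_eq// => x _; congr (_%:E).
  apply: (IH j (fun v => f (rV_cons (x, v)))).
  - exact: continuous_slice_tail.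
  - exact: continuous_slice_tail.
  - by move=> v; apply: is_derive_slice_tail.
  - by move=> v vj; apply: f0; rewrite rV_consS.
rewrite cube_fubini2// /Rintegral integral0_eq// => v _; congr (_%:E).
rewrite -(subrr (f (rV_cons (r, v)))).
have fr : f (rV_cons (- r, v)) = f (rV_cons (r, v)).
  by rewrite !f0// rV_cons0 ?normrN.
rewrite -{2}fr; apply: (@segment_FTC R (- r) r (fun x => f (rV_cons (x, v)))).
- exact: gtrN.
- exact: continuous_slice_head.
- exact: continuous_slice_head.
- by move=> x _; apply: is_derive_slice_head.
Qed.

End cube_calculus.

(** * The logarithmic Sobolev inequality on a cube *)

Section cube_logsobolev.
Context {R : realType}.
Local Notation mu := (@lebesgue_rV R).
Local Notation leb := (@lebesgue_measure R).

Lemma ln_le_subr1 (x : R) : 0 < x -> ln x <= x - 1.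
Proof.
by move=> x0; rewrite lerBrDl -[leRHS](@lnK R) ?posrE// expR_ge1Dx.
Qed.

Lemma rV_cons_coord0 n (x : R) (v : 'rV[R]_n) : (rV_cons (x, v)) ord0 ord0 = x.
Proof. exact: rV_cons0. Qed.

Lemma continuous_coord_comp n (i : 'I_n) (t : R -> R) :
  continuous t -> continuous (fun u : 'rV[R]_n => t (u ord0 i)).
Proof. by move=> ct u; apply: continuous_comp; [exact: coord_continuous|exact: ct]. Qed.

(** When [ln G] is strongly concave, [W] and [b] are [ln G] and its gradient.  They
    are arbitrary here because slicing changes them: when the first coordinate is moved by [th x], the slices
    of [F] at [x] and of [G] at [T x] satisfy it with
    [W + b ord0 * th x - lam / 2 * th x ^+ 2].  The induction hypothesis on the slices,
    together with the Jacobian equation [F1 / mF = G1 (T x) / mG * T'] of the first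
    marginals and [ln T' <= T' - 1], leaves the term [\int F * (T' - 1)], which is
    integrated by parts in the first coordinate. *)
Lemma cube_logsobolev n (r lam : R) (F G W : 'rV[R]_n -> R)
    (DF b : 'I_n -> 'rV[R]_n -> R) :
  0 < r -> 0 < lam -> continuous F -> continuous G -> continuous W ->
  (forall i, continuous (DF i)) -> (forall i, continuous (b i)) ->
  (forall u, 0 < F u) -> (forall u, 0 < G u) ->
  (forall i (u : 'rV[R]_n), is_derive u (delta_mx ord0 i) F (DF i u)) ->
  (forall x y : 'rV[R]_n, ln (G y) <=
     W x + \sum_i b i x * (y ord0 i - x ord0 i)
     - lam / 2 * \sum_i (y ord0 i - x ord0 i) ^+ 2) ->
  \int[mu n]_(u in cube r n)
    (F u * (ln (F u) - W u - (2 * lam)^-1 * \sum_i (b i u - DF i u / F u) ^+ 2))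
  <= (\int[mu n]_(u in cube r n) F u) *
    (ln (\int[mu n]_(u in cube r n) F u) - ln (\int[mu n]_(u in cube r n) G u)).
Proof.
move=> r0 lam0.
elim: n F G W DF b => [|n IH] F G W DF b cF cG cW cDF cb F0 G0 dF GW.
  rewrite !cube_int_dim0 big_ord0 mulr0 subr0 ler_pM2l// lerD2l lerN2.
  by have := GW 0 0; rewrite !big_ord0 mulr0 addr0 subr0.
set mF := \int[_]_(u in _) F u; set mG := \int[_]_(u in _) G u.
have F0' u : F u != 0 by rewrite gt_eqF.
pose F1 x := \int[mu n]_(v in cube r n) F (rV_cons (x, v)).
pose G1 x := \int[mu n]_(v in cube r n) G (rV_cons (x, v)).
have cF1 : continuous F1 by apply: continuous_marginal => //; exact: ltW.
have cG1 : continuous G1 by apply: continuous_marginal => //; exact: ltW.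
have F10 x : 0 < F1 x by apply: cube_int_gt0 => //; exact: continuous_slice_tail.
have G10 x : 0 < G1 x by apply: cube_int_gt0 => //; exact: continuous_slice_tail.
have mF1 : mF = \int[leb]_(x in `[- r, r]) F1 x by exact: cube_fubini1.
have mG1 : mG = \int[leb]_(x in `[- r, r]) G1 x by exact: cube_fubini1.
have mF0 : 0 < mF by exact: cube_int_gt0.
have mG0 : 0 < mG by exact: cube_int_gt0.
have [T [T' [cT cT' [Tmr Tr] dT TT']]] := transport_segment r0 cF1 cG1 F10 G10.
rewrite -mF1 -mG1 in TT'.
pose th x := T x - x.
have cth : continuous th by apply: ctsB => // x; exact: cvg_id.
pose q (u : 'rV[R]_n.+1) := u ord0 ord0.
have cthq : continuous (th \o q) by exact: continuous_coord_comp.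
have cTq : continuous (T' \o q) by exact: continuous_coord_comp.
(* what the induction hypothesis bounds on each slice, with [ln T'] replaced by
   [T' - 1] *)
pose K u := F u * (ln (F u) - (W u + b ord0 u * th (q u) - lam / 2 * th (q u) ^+ 2)
  - (2 * lam)^-1 * \sum_(i < n) (b (lift ord0 i) u - DF (lift ord0 i) u / F u) ^+ 2
  - (T' (q u) - 1 + ln mF - ln mG)).
have cK : continuous K.
  by rewrite /K; cont.
have K_le0 : \int[mu n.+1]_(u in cube r n.+1) K u <= 0.
  rewrite cube_fubini1//.
  have -> : 0 = \int[leb]_(x in `[- r, r]) (cst 0 x : R) by rewrite Rintegral_cst// mul0r.
  apply: le_Rintegral => //.
  - by apply: integrable_segment; apply: continuous_marginal => //; exact: ltW.
  - by apply: integrable_segment; exact: cst_continuous.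
  move=> x xI; have [TxI T'x] := TT' x xI.
  pose Fx v := F (rV_cons (x, v)).
  pose Wx v := W (rV_cons (x, v)) + b ord0 (rV_cons (x, v)) * th x - lam / 2 * th x ^+ 2.
  have cFx : continuous Fx by exact: continuous_slice_tail.
  have cWx : continuous Wx.
    rewrite /Wx; cont; first exact: (continuous_slice_tail cW).
    exact: (continuous_slice_tail (cb ord0)).
  have cDFx i : continuous (fun v => DF (lift ord0 i) (rV_cons (x, v))).
    exact: (continuous_slice_tail (cDF _)).
  have cbx i : continuous (fun v => b (lift ord0 i) (rV_cons (x, v))).
    exact: (continuous_slice_tail (cb _)).
  have GWx (v w : 'rV[R]_n) : ln (G (rV_cons (T x, w))) <= Wx v
      + \sum_i b (lift ord0 i) (rV_cons (x, v)) * (w ord0 i - v ord0 i)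
      - lam / 2 * \sum_i (w ord0 i - v ord0 i) ^+ 2.
    have := GW (rV_cons (x, v)) (rV_cons (T x, w)).
    rewrite !big_ord_recl !rV_cons_coord0.
    under eq_bigr do rewrite !rV_consS.
    under [X in _ <= _ - _ * (_ + X) -> _]eq_bigr do rewrite !rV_consS.
    by rewrite /Wx /th; lra.
  have := IH Fx (fun v => G (rV_cons (T x, v))) Wx
    (fun i v => DF (lift ord0 i) (rV_cons (x, v)))
    (fun i v => b (lift ord0 i) (rV_cons (x, v))) cFx (continuous_slice_tail cG) cWx
    cDFx cbx (fun v => F0 _) (fun v => G0 _)
    (fun i v => is_derive_slice_tail (dF (lift ord0 i) (rV_cons (x, v)))) GWx.
  rewrite -/(F1 x) -/(G1 (T x)) => IHx.
  set c := T' x - 1 + ln mF - ln mG.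
  have lnT : ln (F1 x) - ln (G1 (T x)) <= c.
    have T'0 : 0 < T' x by rewrite T'x mulr_gt0// divr_gt0.
    have := ln_le_subr1 T'0; rewrite {1}T'x lnM ?posrE ?divr_gt0// !ln_div ?posrE//.
    by rewrite /c; lra.
  have KE v : K (rV_cons (x, v)) = Fx v * (ln (Fx v) - Wx v - (2 * lam)^-1 *
      \sum_i (b (lift ord0 i) (rV_cons (x, v)) -
               DF (lift ord0 i) (rV_cons (x, v)) / Fx v) ^+ 2) - c * Fx v.
    by rewrite /K /Wx /Fx /c /q !rV_cons_coord0; ring.
  have Fx0 v : Fx v != 0 by exact: F0'.
  have Fx_gt0 v : 0 < Fx v by exact: F0.
  have -> : (fun v => K (rV_cons (x, v))) = (fun v => Fx v * (ln (Fx v) - Wx v -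
      (2 * lam)^-1 * \sum_i (b (lift ord0 i) (rV_cons (x, v)) -
               DF (lift ord0 i) (rV_cons (x, v)) / Fx v) ^+ 2) - c * Fx v).
    by apply/funext => v; exact: KE.
  rewrite cube_intB; [|by cont|by cont].
  rewrite cube_intZ// subr_le0 (le_trans IHx)// mulrC ler_pM2r//.
(* [P] is the derivative of [F * th] in the first coordinate, and [th] vanishes at
   both ends *)
pose P u := F u * (T' (q u) - 1) + DF ord0 u * th (q u).
have cP : continuous P.
  by rewrite /P; cont.
have P0 : \int[mu n.+1]_(u in cube r n.+1) P u = 0.
  rewrite cube_fubini2// /Rintegral integral0_eq// => v _; congr (_%:E).
  rewrite -[0](_ : F (rV_cons (r, v)) * th r - F (rV_cons (- r, v)) * th (- r) = 0); last first.
    by rewrite /th Tr Tmr !subrr !mulr0 subrr.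
  apply: (@segment_FTC R (- r) r (fun x => F (rV_cons (x, v)) * th x)).
  - exact: gtrN.
  - by apply: ctsM => //; exact: continuous_slice_head.
  - exact: continuous_slice_head.
  - move=> x xI; have dTx := dT x xI.
    have dFx := is_derive_slice_head (dF ord0 (rV_cons (x, v))).
    have := is_deriveM dFx (is_deriveB dTx (is_derive_id x 1)).
    by rewrite /P /q rV_cons_coord0 [X in is_derive _ _ _ X](_ : _ =
      F (rV_cons (x, v)) * (T' x - 1) + DF ord0 (rV_cons (x, v)) * th x)//
      [X in _ + X]mulrC.
have cA : continuous (fun u => F u * (ln (F u) - W u -
    (2 * lam)^-1 * \sum_i (b i u - DF i u / F u) ^+ 2)) by cont.
rewrite [leRHS]mulrC -subr_le0 {2}/mF -cube_intZ// -cube_intB//; last by cont.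
apply: (@le_trans _ _ (\int[mu n.+1]_(u in cube r n.+1) (K u + P u))).
  apply: cube_int_le => [||u _]; [by cont|by cont|].
  rewrite -subr_ge0 big_ord_recl /K /P.
  (* completing the square in [th] produces the missing term of the sum *)
  rewrite [leRHS](_ : _ = F u * (lam / 2 *
      (th (q u) - (b ord0 u - DF ord0 u / F u) / lam) ^+ 2)); last first.
    by field; rewrite F0' gt_eqF.
  apply: mulr_ge0; first exact: ltW.
  by rewrite mulr_ge0 ?sqr_ge0// divr_ge0// ltW.
by rewrite cube_intD// P0 addr0.
Qed.
End cube_logsobolev.

(** * Exhaustion of the space by cubes *)

Section real_integrable.
Context {R : realType} {d : measure_display} {T : measurableType d}.
Variables (mu : {measure set T -> \bar R}).
Implicit Types f g : T -> R.

Lemma integrable_addr f g : mu.-integrable setT (EFin \o f) ->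
  mu.-integrable setT (EFin \o g) -> mu.-integrable setT (EFin \o (fun u => f u + g u)).
Proof. by move=> intf intg; apply: eq_integrable (integrableD _ intf intg). Qed.

Lemma integrable_subr f g : mu.-integrable setT (EFin \o f) ->
  mu.-integrable setT (EFin \o g) -> mu.-integrable setT (EFin \o (fun u => f u - g u)).
Proof. by move=> intf intg; apply: eq_integrable (integrableB _ intf intg). Qed.

Lemma integrable_scaler f (k : R) : mu.-integrable setT (EFin \o f) ->
  mu.-integrable setT (EFin \o (fun u => k * f u)).
Proof. by move=> intf; apply: eq_integrable (integrableZl _ k intf). Qed.

Lemma integrable_bound f g (M : R) :
  measurable_fun setT f -> mu.-integrable setT (EFin \o g) ->
  (forall u, `|f u| <= M * g u) -> mu.-integrable setT (EFin \o f).
Proof.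
move=> mf ig fMg; apply: (le_integrable _ _ _ (integrable_scaler M ig)) => //.
  exact/measurable_EFinP.
by move=> u _; rewrite /= lee_fin (le_trans (fMg u))// ler_norm.
Qed.
End real_integrable.

Section exhaustion.
Context {R : realType}.
Local Notation mu := (@lebesgue_rV R).
Local Notation leb := (@lebesgue_measure R).

Lemma near_cube n (u : 'rV[R]_n) : \forall k \near \oo, cube k.+1%:R n u.
Proof.
near=> k; have uk : `|u| <= k.+1%:R.
  near: k; exists (Num.truncn `|u|) => // k /= uk.
  apply/ltW/(lt_le_trans (truncnS_gt _)); by rewrite ler_nat ltnS.
move=> i; rewrite in_itv/= -ler_norml (le_trans _ uk)//.
rewrite [leRHS]/Num.norm/= mx_normrE.
by apply: (@le_bigmax _ _ _ _ (fun ij : 'I_1 * 'I_n => `|u ij.1 ij.2|) (ord0, i)).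
Unshelve. all: by end_near. Qed.

Lemma cube_subset (r s : R) n : r <= s -> cube r n `<=` cube s n.
Proof.
move=> rs u uQ i; have := uQ i; rewrite !in_itv/= => /andP[h1 h2].
by rewrite (le_trans _ h1) ?lerN2// (le_trans h2).
Qed.

(** The factor [chi] will be either a cutoff ([l = 1]) or a derivative of a cutoff
    ([l = 0]). *)
Lemma cvg_cube_int n (f : 'rV[R]_n -> R) (chi : nat -> 'rV[R]_n -> R) (M l : R) :
  (mu n).-integrable setT (EFin \o f) ->
  (forall k, continuous (chi k)) ->
  (forall k u, cube k.+1%:R n u -> `|chi k u| <= M) ->
  (forall u, chi k u @[k --> \oo] --> l) ->
  \int[mu n]_(u in cube k.+1%:R n) (chi k u * f u) @[k --> \oo] -->
  l * \int[mu n]_u f u.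
Proof.
move=> intf cchi chiM chi_cvg; rewrite -RintegralZl//.
have /integrableP[/measurable_EFinP mf _] := intf.
have M0 : 0 <= M.
  have [k _ /(_ k (leqnn k)) kQ] := near_cube (0 : 'rV[R]_n).
  exact: le_trans (normr_ge0 _) (chiM _ _ kQ).
rewrite /Rintegral.
apply: fine_cvg; rewrite fineK; last first.
  apply: integrable_fin_num => //; under eq_fun do rewrite EFinM.
  exact: integrableZl.
under eq_cvg => k do rewrite integral_mkcond.
apply: (@dominated_cvg _ _ _ _ _ measurableT _ _ (fun u => (M%:E * `|f u|%:E)%E)) => //.
- move=> k; apply/(measurable_restrictT _ (measurable_cube _ _)).
  apply/measurable_EFinP; apply: measurable_funTS.
  by apply: measurable_funM => //; exact: continuous_measurable_rV.
- move=> u _; apply: (@cvg_trans _ ((chi k u * f u)%:E @[k --> \oo])).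
    apply: near_eq_cvg; near=> k; rewrite /patch mem_set//.
    by near: k; exact: near_cube.
  apply: cvg_EFin; first exact: nearW.
  by apply: cvgM; [exact: chi_cvg|exact: cvg_cst].
- by apply: integrableZl => //; have := intf; move/integrable_abse.
- move=> k u _; rewrite /patch; case: ifPn => [/set_mem uQ|_].
    by rewrite abse_EFin lee_fin normrM ler_wpM2r// chiM.
  by rewrite abse0 mule_ge0 ?lee_fin.
Unshelve. all: by end_near. Qed.

Lemma cvg_cube_int1 n (f : 'rV[R]_n -> R) :
  (mu n).-integrable setT (EFin \o f) ->
  \int[mu n]_(u in cube k.+1%:R n) f u @[k --> \oo] --> \int[mu n]_u f u.
Proof.
move=> intf; have := @cvg_cube_int n f (fun _ => cst 1) 1 1 intf.
under eq_cvg => k do under eq_Rintegral => u _ do rewrite mul1r.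
rewrite mul1r; apply=> *; [exact: cst_continuous|by rewrite normr1|exact: cvg_cst].
Qed.

(** Monotone convergence; integrability is part of the conclusion, which is how the
    finiteness of the entropy is obtained. *)
Lemma cube_int_bounded n (f : 'rV[R]_n -> R) (B : nat -> R) (L : R) :
  continuous f -> (forall u, 0 <= f u) ->
  (forall k, \int[mu n]_(u in cube k.+1%:R n) f u <= B k) ->
  B k @[k --> \oo] --> L ->
  (mu n).-integrable setT (EFin \o f) /\ \int[mu n]_u f u <= L.
Proof.
move=> cf f0 fB BL; have mf := continuous_measurable_rV cf.
pose g k u := ((EFin \o f) \_ (cube k.+1%:R n)) u.
have mg k : measurable_fun setT (g k).
  apply/(measurable_restrictT _ (measurable_cube _ _)).
  by apply/measurable_EFinP; exact: measurable_funTS.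
have g0 k u : setT u -> (0 <= g k u)%E.
  by move=> _; rewrite /g /patch; case: ifPn => // _; rewrite lee_fin.
have ndg u : setT u -> nondecreasing_seq (g ^~ u).
  move=> _ k l kl; rewrite /g /patch; case: ifPn => [/set_mem uk|_].
    by rewrite mem_set//; apply: cube_subset uk; rewrite ler_nat.
  by case: ifPn => // _; rewrite lee_fin.
have := @cvg_monotone_convergence _ _ _ (mu n) _ measurableT g mg g0 ndg.
have -> : (\int[mu n]_u limn (g ^~ u))%E = (\int[mu n]_u (f u)%:E)%E.
  apply: eq_integral => u _; apply/cvg_lim => //.
  apply: (@cvg_trans _ ((f u)%:E @[k --> \oo])); last exact: cvg_cst.
  apply: near_eq_cvg; near=> k; rewrite /g /patch mem_set//.
  by near: k; exact: near_cube.
move=> gf.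
have fL : (\int[mu n]_u (f u)%:E <= L%:E)%E.
  have BL' : (B k)%:E @[k --> \oo] --> L%:E by apply: cvg_EFin => //; exact: nearW.
  apply: (lee_cvg_to gf BL'); near=> k; rewrite /g -integral_mkcond.
  rewrite -[leLHS]fineK ?lee_fin; first exact: fB.
  by apply: integrable_fin_num; [exact: measurable_cube|exact: integrable_cube].
have intf : (mu n).-integrable setT (EFin \o f).
  apply/integrableP; split; first exact/measurable_EFinP.
  under eq_integral do rewrite /= ger0_norm//.
  exact: le_lt_trans fL (ltry _).
split=> //; rewrite -lee_fin /Rintegral fineK//.
exact: integrable_fin_num.
Unshelve. all: by end_near. Qed.

(** On a cube the integral is a product of one-dimensional Gaussian integrals, each
    at most [C], so it is bounded independently of the cube. *)
Lemma integrable_gaussian n (a : R) : 0 < a ->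
  (mu n).-integrable setT (fun u => (expR (- a * \sum_i u ord0 i ^+ 2))%:E).
Proof.
move=> a0; pose s := Num.sqrt (2 * a)^-1.
have s0 : 0 < s by rewrite sqrtr_gt0 invr_gt0 mulr_gt0.
have sE : s ^+ 2 *+ 2 = a^-1.
  by rewrite sqr_sqrtr ?invr_ge0 ?mulr_ge0 ?ltW// invfM mulrC -mulr_natr divfK.
pose g x := expR (- a * x ^+ 2).
have cg : continuous g by apply: cts_expR; apply: ctsM; [exact: cst_continuous|apply: ctsX => x; exact: cvg_id].
pose C := (normal_peak s)^-1.
have gC (r : R) : \int[leb]_(x in `[- r, r]) g x <= C.
  have gE : g = fun x => C * normal_pdf 0 s x.
    apply/funext => x; rewrite normal_pdfE ?gt_eqF// /C mulrA mulVf ?mul1r; last first.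
      by rewrite gt_eqF// normal_peak_gt0// gt_eqF.
    by rewrite /normal_fun sE invrK subr0 /g; congr expR; ring.
  have ipdf := @integrable_normal_pdf R 0 s.
  rewrite gE RintegralZl//; last exact: integrableS ipdf.
  rewrite ler_piMr ?invr_ge0 ?normal_peak_ge0// -lee_fin fineK; last first.
    by apply: integrable_fin_num => //; exact: integrableS ipdf.
  rewrite -(@integral_normal_pdf R 0 s); apply: ge0_subset_integral => //.
    by apply/measurable_EFinP; exact: measurable_normal_pdf.
  by move=> x _; rewrite lee_fin normal_pdf_ge0.
have C0 : 0 <= C by rewrite invr_ge0 normal_peak_ge0.
have gn m u : expR (- a * \sum_(i < m) u i ^+ 2) = \prod_(i < m) g (u i).
  by rewrite mulr_sumr expR_sum.
have cgn m : continuous (fun u : 'rV[R]_m => \prod_(i < m) g (u ord0 i)).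
  by apply: cts_prod => i; exact: continuous_coord_comp.
have gnC m (r : R) : 0 <= r ->
    \int[mu m]_(u in cube r m) (\prod_(i < m) g (u ord0 i)) <= C ^+ m.
  move=> r0; elim: m => [|m IH]; first by rewrite cube_int_dim0 big_ord0.
  rewrite cube_fubini1//.
  rewrite (_ : (fun x => _) = (fun x => g x *
    \int[mu m]_(v in cube r m) (\prod_(i < m) g (v ord0 i)))); last first.
    apply/funext => x; rewrite -cube_intZ//; apply: eq_Rintegral => v _.
    by rewrite big_ord_recl rV_cons_coord0; under eq_bigr do rewrite rV_consS.
  rewrite RintegralZr//; last exact: integrable_segment.
  rewrite exprS ler_pM//.
  - by apply: Rintegral_ge0 => x _; exact: expR_ge0.
  - by apply: Rintegral_ge0 => x _; apply: prodr_ge0 => i _; exact: expR_ge0.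
have [|k||] := @cube_int_bounded n (fun u => \prod_(i < n) g (u ord0 i))
    (cst (C ^+ n)) (C ^+ n) (cgn n).
- by move=> u; apply: prodr_ge0 => i _; exact: expR_ge0.
- exact: gnC.
- exact: cvg_cst.
by move=> + _; apply: eq_integrable => // u _; rewrite /= gn.
Qed.

End exhaustion.

(** * Strong convexity *)

Section strong_convexity.
Context {R : realType}.
Local Notation mu := (@lebesgue_rV R).

Lemma derive_partial n (f : 'rV[R]_n -> R) (u w : 'rV[R]_n) :
  differentiable f u -> 'D_w f u = \sum_i w ord0 i * partial i f u.
Proof.
move=> df; rewrite deriveE// [w in LHS]row_sum_delta linear_sum; apply: eq_bigr => i _.
by rewrite linearZ /partial deriveE.
Qed.

Lemma is_derive_line n (f : 'rV[R]_n -> R) (u w : 'rV[R]_n) (s : R) :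
  differentiable f (u + s *: w) ->
  is_derive s 1 (fun s => f (u + s *: w))
    (\sum_i w ord0 i * partial i f (u + s *: w)).
Proof.
move=> df; rewrite -derive_partial//.
have [dfw _] : is_derive (u + s *: w) w f ('D_w f (u + s *: w)).
  by apply: DeriveDef => //; exact: diff_derivable.
have E : (fun h : R => h^-1 *: ((f \o shift (u + s *: w)) (h *: w) - f (u + s *: w))) =
    (fun h => h^-1 *: (((fun s => f (u + s *: w)) \o shift s) (h *: 1) - f (u + s *: w))).
  by apply/funext => h /=; rewrite scalerDl (addrCA u) [h *: 1]mulr1.
by move: dfw; rewrite /derivable /derive E => dfw; apply: (DeriveDef dfw).
Qed.

Lemma qformE n (A : 'M[R]_n) (x : 'rV[R]_n) :
  qform A x = \sum_i \sum_j x ord0 i * x ord0 j * A i j.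
Proof.
rewrite /qform mxE exchange_big/=; apply: eq_bigr => j _.
rewrite !mxE mulr_suml; apply: eq_bigr => i _; ring.
Qed.

Lemma loewner_le_scalar n (a : R) (A : 'M[R]_n) (x : 'rV[R]_n) :
  loewner_le a%:M A -> a * \sum_i x ord0 i ^+ 2 <= qform A x.
Proof.
move=> [_ /(_ x)]; rewrite /qform mulmxBr mulmxBl mxE [X in _ + X]mxE subr_ge0.
congr (_ <= _); rewrite mul_mx_scalar -scalemxAl mxE mxE; congr (_ * _).
by apply: eq_bigr => i _; rewrite mxE expr2.
Qed.

(** Two applications of the mean value theorem on the segment from [u] to [v]: to the
    first derivative of [Phi] along it, then to [Phi] itself, both corrected by the
    quadratic term. *)
Lemma strong_convexity n (lam : R) (Phi : 'rV[R]_n -> R) : C2 Phi ->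
  (forall u, loewner_le lam%:M (hessian Phi u)) ->
  forall u v : 'rV[R]_n, Phi u + \sum_i partial i Phi u * (v ord0 i - u ord0 i)
    + lam / 2 * \sum_i (v ord0 i - u ord0 i) ^+ 2 <= Phi v.
Proof.
move=> [[dPhi _] C1Phi] hess u v; pose w := v - u.
have wE i : w ord0 i = v ord0 i - u ord0 i by rewrite !mxE.
under eq_bigr do rewrite -wE; under [X in _ + _ * X]eq_bigr do rewrite -wE.
pose N := \sum_i w ord0 i ^+ 2.
pose g' s := \sum_i w ord0 i * partial i Phi (u + s *: w).
pose g'' s := \sum_i w ord0 i * \sum_j w ord0 j * partial j (partial i Phi) (u + s *: w).
have dg (s : R) : is_derive s 1 (fun s => Phi (u + s *: w)) (g' s) by exact: is_derive_line.
have dg' (s : R) : is_derive s 1 g' (g'' s).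
  have dh i : is_derive s 1 (fun s => partial i Phi (u + s *: w))
      (\sum_j w ord0 j * partial j (partial i Phi) (u + s *: w)).
    by apply: is_derive_line; have [] := C1Phi i.
  have := is_derive_sum (fun i => is_deriveZ (w ord0 i) (dh i)).
  by rewrite (_ : \sum_i _ = g')//; apply/funext => t; rewrite /g' fct_sumE.
have g''_ge s : lam * N <= g'' s.
  rewrite (le_trans (loewner_le_scalar w (hess (u + s *: w))))// qformE exchange_big/=.
  rewrite le_eqVlt; apply/orP; left; apply/eqP.
  by apply: eq_bigr => i _; rewrite mulr_sumr; apply: eq_bigr => j _; rewrite [hessian _ _ _ _]mxE; ring.
have cont_of (h h' : R -> R) : (forall s : R, is_derive s 1 h (h' s)) ->
    {within `[0, 1], continuous h}.
  by move=> dh; apply: continuous_subspaceT => s; exact: is_derive_continuous (dh s).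
have dq (s : R) : is_derive s 1 (fun s : R => s ^+ 2) (2 * s).
  have := is_deriveX 2 (is_derive_id s (1 : R)).
  by rewrite /= expr1 [_ *: 1]mulr1.
pose k s := g' s - lam * N * s.
have dk (s : R) : is_derive s 1 k (g'' s - lam * N).
  have := is_deriveB (dg' s) (is_deriveZ (lam * N) (is_derive_id s (1 : R))).
  by rewrite [_ *: 1]mulr1.
have k_ge s : 0 <= s -> k 0 <= k s.
  rewrite le_eqVlt => /predU1P[<-//|s0].
  have [|c _ kE] := @MVT _ k (fun s => g'' s - lam * N) 0 s s0 (fun s _ => dk s).
    by apply: continuous_subspaceT => t; exact: is_derive_continuous (dk t).
  by rewrite -subr_ge0 kE mulr_ge0 ?subr_ge0// ltW.
pose m s := Phi (u + s *: w) - (g' 0 * s + lam * N / 2 * s ^+ 2).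
have dm (s : R) : is_derive s 1 m (k s - k 0).
  have := is_deriveB (dg s) (is_deriveD (is_deriveZ (g' 0) (is_derive_id s (1 : R)))
    (is_deriveZ (lam * N / 2) (dq s))).
  rewrite (_ : g' s - _ = k s - k 0)// /k mulr0 subr0.
  rewrite [_ *: 1]mulr1 [_ *: (2 * s)](_ : _ = lam * N * s); first by ring.
  by rewrite [_ *: _]mulrA divfK.
have [|c c01 mE] := @MVT _ m (fun s => k s - k 0) 0 1 ltr01 (fun s _ => dm s).
  exact: cont_of dm.
have : 0 <= m 1 - m 0.
  rewrite mE subr0 mulr1 subr_ge0 k_ge//.
  by move: c01; rewrite in_itv/= => /andP[/ltW].
rewrite /m scale0r scale1r addr0 mulr0 expr0n/= mulr0 addr0 subr0 expr1n !mulr1.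
rewrite /w (addrC u) subrK -/w /g' scale0r addr0.
under eq_bigr do rewrite mulrC.
by rewrite -/N; lra.
Qed.

(** By strong convexity at the origin, [Phi] is at least a quadratic polynomial with
    leading part [lam / 2]; half of it absorbs the linear term. *)
Lemma integrable_expRN n (lam : R) (Phi : 'rV[R]_n -> R) : 0 < lam -> C2 Phi ->
  (forall u, loewner_le lam%:M (hessian Phi u)) -> continuous Phi ->
  (mu n).-integrable setT (fun u => (expR (- Phi u))%:E).
Proof.
move=> lam0 C2Phi hess cPhi.
pose b i := partial i Phi 0.
pose C := expR (- Phi 0 + \sum_i b i ^+ 2 / lam).
have PhiC u : expR (- Phi u) <= C * expR (- (lam / 4) * \sum_i u ord0 i ^+ 2).
  rewrite /C -expRD ler_expR.
  have := strong_convexity C2Phi hess 0 u.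
  under eq_bigr do rewrite mxE subr0 -/(b _).
  under [X in _ + _ * X]eq_bigr do rewrite mxE subr0.
  have : 0 <= \sum_i (b i ^+ 2 / lam + b i * u ord0 i + lam / 4 * u ord0 i ^+ 2).
    apply: sumr_ge0 => i _.
    rewrite (_ : _ + _ = lam^-1 * (b i + lam / 2 * u ord0 i) ^+ 2).
      by rewrite mulr_ge0 ?sqr_ge0// invr_ge0 ltW.
    by field; rewrite gt_eqF.
  rewrite !big_split/= -mulr_sumr; lra.
have intC : (mu n).-integrable setT
    (EFin \o (fun u => C * expR (- (lam / 4) * \sum_i u ord0 i ^+ 2))).
  rewrite (_ : EFin \o _ = fun u => (C%:E *
    (expR (- (lam / 4) * \sum_i u ord0 i ^+ 2))%:E)%E); last first.
    by apply/funext => u; rewrite -EFinM.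
  by apply: integrableZl => //; apply: integrable_gaussian; rewrite divr_gt0.
apply: (le_integrable _ _ _ intC) => //.
  by apply/measurable_EFinP; apply: continuous_measurable_rV; cont.
move=> u _; rewrite /= lee_fin ger0_norm ?expR_ge0// ger0_norm ?mulr_ge0 ?expR_ge0//.
Qed.

End strong_convexity.

(** * Cutoffs and integration by parts in the whole space *)

Section dissipation.
Context {R : realType} {n : nat}.
Local Notation mu := (@lebesgue_rV R n).
Implicit Types (u : 'rV[R]_n) (i j : 'I_n) (r : R).

Local Notation e i := (delta_mx ord0 i : 'rV[R]_n).

Lemma is_derive_coord i u : is_derive u (e i) (fun u => u ord0 i) (1 : R).
Proof.
have H : h^-1 *: (((fun u : 'rV[R]_n => u ord0 i) \o shift u) (h *: e i) - u ord0 i)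
    @[h --> (0 : R)^'] --> (1 : R).
  apply: (@cvg_trans _ ((1 : R) @[h --> (0 : R)^'])); last exact: cvg_cst.
  apply: near_eq_cvg; near=> h.
  have h0 : h != 0 by near: h; exact: nbhs_dnbhs_neq.
  by rewrite /= !mxE !eqxx/= mulr1 addrK [_ *: _]mulVf.
by apply: DeriveDef; [apply/cvg_ex; exists 1|exact: cvg_lim].
Unshelve. all: by end_near. Qed.

Lemma is_derive_invariant (f : 'rV[R]_n -> R) u v :
  (forall h : R, f (h *: v + u) = f u) -> is_derive u v f 0.
Proof.
move=> fu; have E : (fun h : R => h^-1 *: ((f \o shift u) (h *: v) - f u)) = cst 0.
  by apply/funext => h; rewrite /= fu subrr scaler0.
by apply: DeriveDef; rewrite /derivable /derive E; [exact: is_cvg_cst|exact: lim_cst].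
Qed.

(** Vanishing on the faces of the cube is all that integration by parts on the cube
    asks of a cutoff, so a polynomial will do. *)
Definition cutoff r u : R := \prod_i (1 - (u ord0 i / r) ^+ 2).

Definition dcutoff i r u : R :=
  - (2 * u ord0 i / r ^+ 2) * \prod_(j | j != i) (1 - (u ord0 j / r) ^+ 2).

Lemma continuous_cutoff r : continuous (cutoff r).
Proof. by rewrite /cutoff; cont; exact: coord_continuous. Qed.

Lemma continuous_dcutoff i r : continuous (dcutoff i r).
Proof. by rewrite /dcutoff; cont; exact: coord_continuous. Qed.

(** Only the factor of index [i] varies in the direction of the [i]-th coordinate. *)
Lemma is_derive_cutoff i r u : is_derive u (e i) (cutoff r) (dcutoff i r u).
Proof.
pose p (v : 'rV[R]_n) := \prod_(j | j != i) (1 - (v ord0 j / r) ^+ 2).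
have dp : is_derive u (e i) p 0.
  apply: is_derive_invariant => h; apply: eq_bigr => j ji.
  by rewrite !mxE (negbTE ji) andbF mulr0 add0r.
pose s (v : 'rV[R]_n) := (v ord0 i) ^+ 2.
have ds : is_derive u (e i) s (2 * u ord0 i).
  have := is_deriveX 2 (is_derive_coord i u).
  by rewrite /= expr1 [_ *: 1]mulr1.
have := is_deriveM (is_deriveB (is_derive_cst (1 : R) u (e i))
   (is_deriveZ (r ^- 2) ds)) dp.
rewrite scaler0 add0r sub0r /dcutoff -/(p u).
rewrite [X in is_derive _ _ X _](_ : _ = cutoff r); last first.
  apply/funext => v; rewrite /cutoff (bigD1 i)//= !fctE /p; congr (_ * _).
  by rewrite /s /= exprMn exprVn; congr (1 - _); exact: mulrC.
rewrite [X in is_derive _ _ _ X](_ : _ = - (2 * u ord0 i / r ^+ 2) * p u)//.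
by rewrite [_ *: _]mulrC; congr (- _ * _); exact: mulrC.
Qed.

Lemma cutoff_factor r u i : 0 < r -> cube r n u -> 0 <= 1 - (u ord0 i / r) ^+ 2 <= 1.
Proof.
move=> r0 uQ; have := uQ i; rewrite in_itv/= -ler_norml => uir.
rewrite subr_ge0 gerBl sqr_ge0 andbT -[leLHS]real_normK ?num_real// expr_le1//.
by rewrite normrM normfV (ger0_norm (ltW r0)) ler_pdivrMr// mul1r.
Qed.

Lemma cutoff_ge0 r u : 0 < r -> cube r n u -> 0 <= cutoff r u.
Proof. by move=> r0 uQ; apply: prodr_ge0 => i _; have /andP[] := cutoff_factor i r0 uQ. Qed.

Lemma cutoff_norm_le1 r u : 0 < r -> cube r n u -> `|cutoff r u| <= 1.
Proof.
move=> r0 uQ; rewrite ger0_norm ?cutoff_ge0//; apply: prodr_ile1 => i _.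
exact: cutoff_factor.
Qed.

Lemma dcutoff_norm_le i r u : 0 < r -> cube r n u -> `|dcutoff i r u| <= 2 / r.
Proof.
move=> r0 uQ; rewrite normrM.
rewrite (@le_trans _ _ (`|- (2 * u ord0 i / r ^+ 2)|))//.
  rewrite ler_piMr// ger0_norm; last first.
    by apply: prodr_ge0 => j _; have /andP[] := cutoff_factor j r0 uQ.
  by apply: prodr_ile1 => j _; exact: cutoff_factor.
have := uQ i; rewrite in_itv/= -ler_norml => uir.
rewrite normrN !normrM normfV (ger0_norm (x := r ^+ 2)) ?sqr_ge0// (ger0_norm (x := 2))//.
rewrite expr2 invfM mulrA ler_pM2r ?invr_gt0//.
by rewrite -mulrA ler_piMr// ler_pdivrMr// mul1r.
Qed.

Lemma cutoff_face r u i : 0 < r -> `|u ord0 i| = r -> cutoff r u = 0.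
Proof.
move=> r0 ur; rewrite /cutoff (bigD1 i)//= [X in X * _](_ : _ = 0) ?mul0r//.
rewrite -(real_normK (num_real (u ord0 i / r))) normrM ur normfV ger0_norm ?ltW//.
by rewrite divff ?gt_eqF// expr1n subrr.
Qed.

Lemma cutoff_cvg u : cutoff k.+1%:R u @[k --> \oo] --> (1 : R).
Proof.
pose p (t : R) := \prod_(i < n) (1 - (u ord0 i * t) ^+ 2).
have cp : continuous p by rewrite /p; cont => t; exact: cvg_id.
rewrite [X in _ --> X](_ : _ = p 0); last first.
  by rewrite /p big1// => i _; rewrite mulr0 expr0n subr0.
exact: (cvg_comp (@harmonic R) p (@cvg_harmonic R) (cp 0)).
Qed.

Lemma dcutoff_cvg i u : dcutoff i k.+1%:R u @[k --> \oo] --> (0 : R).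
Proof.
apply: norm_cvg0.
apply: (@squeeze_cvgr _ _ _ _ (cst 0) (fun k => 2 / k.+1%:R)).
- near=> k; rewrite normr_ge0/= dcutoff_norm_le//.
  by near: k; exact: near_cube.
- exact: cvg_cst.
- rewrite -[X in _ --> X](mulr0 2); apply: cvgM; [exact: cvg_cst|exact: cvg_harmonic].
Unshelve. all: by end_near. Qed.
Lemma cube_int_sum r (I : Type) (s : seq I) (f : I -> 'rV[R]_n -> R) :
  (forall a, continuous (f a)) ->
  \int[mu]_(u in cube r n) (\sum_(a <- s) f a u) =
  \sum_(a <- s) \int[mu]_(u in cube r n) f a u.
Proof.
move=> cf; elim: s => [|a s IH].
  rewrite big_nil; under eq_Rintegral do rewrite big_nil.
  by rewrite Rintegral_cst ?mul0r//; exact: measurable_cube.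
rewrite big_cons -IH -cube_intD//; last exact: cts_sum.
by apply: eq_Rintegral => u _; rewrite big_cons.
Qed.

(** Each factor decreases with the modulus of its coordinate, which is at most [s]. *)
Lemma cutoff_ge_corner (r s : R) (u v : 'rV[R]_n) : 0 < s -> s <= r -> cube s n u ->
  (forall i, v ord0 i = s) -> cutoff r v <= cutoff r u.
Proof.
move=> s0 sr us vE; have r0 := lt_le_trans s0 sr.
apply: ler_prod => i _; rewrite vE.
have vr : cube r n v.
  by move=> j; rewrite vE in_itv/= sr andbT (le_trans _ (ltW s0))// oppr_le0 ltW.
have := cutoff_factor i r0 vr; rewrite vE => /andP[-> _] /=.
rewrite lerD2l lerN2 !exprMn ler_pM2r; last by rewrite exprn_gt0 ?invr_gt0.
have := us i; rewrite in_itv/= -ler_norml => usi.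
by rewrite -[leLHS]real_normK ?num_real// lerXn2r ?nnegrE// ltW.
Qed.

(** Integrate [h * div J] by parts against the cutoffs of larger and larger cubes:
    the terms that carry a derivative of the cutoff vanish in the limit because
    [h * J] is integrable.  As the integrand on the left is nonnegative, its
    integral on a fixed cube is bounded by the integrals against the cutoffs, up to
    a factor that tends to one. *)
Lemma cube_dissipation (h : 'rV[R]_n -> R) (J DJ Dh : 'I_n -> 'rV[R]_n -> R) (s : nat) :
  continuous h -> (forall i, continuous (J i)) ->
  (forall i, continuous (DJ i)) -> (forall i, continuous (Dh i)) ->
  (forall i u, is_derive u (e i) (J i) (DJ i u)) ->
  (forall i u, is_derive u (e i) h (Dh i u)) ->
  mu.-integrable setT (EFin \o (fun u => h u * \sum_i DJ i u)) ->
  (forall i, mu.-integrable setT (EFin \o (fun u => h u * J i u))) ->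
  (forall u, 0 <= \sum_i J i u * Dh i u) ->
  \int[mu]_(u in cube s.+1%:R n) (\sum_i J i u * Dh i u) <=
  - \int[mu]_u (h u * \sum_i DJ i u).
Proof.
move=> ch cJ cDJ cDh dJ dh int_hDJ int_hJ X0.
set X := fun u => \sum_i J i u * Dh i u.
have cX : continuous X by rewrite /X; cont.
have cDJs : continuous (fun u => \sum_i DJ i u) by cont.
have cchi r := @continuous_cutoff r; have cdchi i r := @continuous_dcutoff i r.
pose B k := - (\int[mu]_(u in cube k.+1%:R n) (cutoff k.+1%:R u * (h u * \sum_i DJ i u)))
  - \sum_i \int[mu]_(u in cube k.+1%:R n) (dcutoff i k.+1%:R u * (h u * J i u)).
have k0 k : 0 < k.+1%:R :> R by [].
(* integration by parts on the cube of the [k]-th cutoff *)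
have BE k : \int[mu]_(u in cube k.+1%:R n) (cutoff k.+1%:R u * X u) = B k.
  set r := k.+1%:R; have r0 : 0 < r := k0 k.
  pose D i u := cutoff r u * (h u * DJ i u + Dh i u * J i u) + dcutoff i r u * (h u * J i u).
  have cD i : continuous (D i) by rewrite /D; cont.
  have D0 : \sum_i \int[mu]_(u in cube r n) D i u = 0.
    apply: big1 => i _.
    apply: (@cube_int_partial _ _ _ i (fun u => cutoff r u * (h u * J i u))) => //.
    - by cont.
    - move=> u; have dhu := dh i u; have dJu := dJ i u.
      have := is_deriveM (is_derive_cutoff i r u) (is_deriveM dhu dJu).
      rewrite [X in is_derive _ _ _ X -> _](_ : _ = D i u)//.
      rewrite /D; congr (_ * (_ + _) + _); exact: mulrC.
    - by move=> u ui; rewrite (cutoff_face r0 ui) mul0r.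
  apply/eqP; rewrite /B -/r -subr_eq0 opprB opprK addrCA addrC -cube_int_sum; last first.
    by move=> i; cont.
  rewrite -cube_intD; [|by cont|by cont].
  rewrite -cube_intD; [|by cont|by cont].
  rewrite -[X in _ == X]D0 -cube_int_sum//; apply/eqP; apply: eq_Rintegral => u _.
  rewrite /D /X big_split/= -mulr_sumr big_split/= -mulr_sumr.
  by under [X in _ = _ * (_ + X) + _]eq_bigr do rewrite mulrC; ring.
have Bcvg : B k @[k --> \oo] --> - \int[mu]_u (h u * \sum_i DJ i u).
  rewrite -[X in _ --> X]subr0; apply: cvgB.
    apply: cvgN; rewrite -[X in _ --> X]mul1r.
    apply: cvg_cube_int => // [k u uQ|u]; first exact: cutoff_norm_le1 uQ.
    exact: cutoff_cvg.
  rewrite [X in _ --> X](_ : 0 = \sum_(i < n) 0 * \int[mu]_u (h u * J i u)); last first.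
    by rewrite big1// => i _; rewrite mul0r.
  apply: cvg_big => [|i _]; first exact: add_continuous.
  apply: (@cvg_cube_int _ _ _ _ 2) => // [k u uQ|u]; last exact: dcutoff_cvg.
  rewrite (le_trans (dcutoff_norm_le i (k0 k) uQ))// ler_pdivrMr// ler_peMr//.
  by rewrite ler1n.
pose v : 'rV[R]_n := \row_i s.+1%:R.
set I := \int[mu]_(u in _) _.
(* the factor lost on the fixed cube is the value of the cutoff at its corner [v] *)
have Icvg : cutoff k.+1%:R v * I @[k --> \oo] --> I.
  rewrite -[X in _ --> X]mul1r; apply: cvgM; [exact: cutoff_cvg|exact: cvg_cst].
apply: (ler_cvg_to Icvg Bcvg); near=> k.
have sk : (s <= k)%N by near: k; exists s.
rewrite -BE -cube_intZ//.
have mS := measurable_cube (s.+1%:R : R) n; have mK := measurable_cube (k.+1%:R : R) n.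
have sub : cube (s.+1%:R : R) n `<=` cube k.+1%:R n by apply: cube_subset; rewrite ler_nat.
apply: (@le_trans _ _ (\int[mu]_(u in cube s.+1%:R n) (cutoff k.+1%:R u * X u))).
  apply: cube_int_le => [||u uQ]; [by cont|by cont|].
  rewrite ler_wpM2r//; apply: cutoff_ge_corner uQ _ => //; first by rewrite ler_nat.
  by move=> i; rewrite mxE.
have intK (r : R) : mu.-integrable (cube r n) (EFin \o (fun u => cutoff k.+1%:R u * X u)).
  by apply: integrable_cube; cont.
rewrite /Rintegral fine_le//.
- by apply: integrable_fin_num.
- by apply: integrable_fin_num.
apply: ge0_subset_integral => //.
  by have /integrableP[] := intK k.+1%:R.
move=> u uQ; rewrite lee_fin; apply: mulr_ge0; last exact: X0.
exact: cutoff_ge0 uQ.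
Unshelve. all: by end_near. Qed.

End dissipation.

(** * Entropy dissipation at a fixed time *)

Section entropy_production.
Context {R : realType} {n : nat}.
Local Notation mu := (@lebesgue_rV R n).
Implicit Types (u : 'rV[R]_n) (f Phi r : 'rV[R]_n -> R).

Local Notation e i := (delta_mx ord0 i : 'rV[R]_n).

(** Carries the chain rule over from functions of one real variable to directional
    derivatives. *)
Lemma is_derive_restrict_line f u v D :
  is_derive u v f D <-> is_derive (0 : R) 1 (fun s : R => f (s *: v + u)) D.
Proof.
have E : (fun h : R => h^-1 *: ((f \o shift u) (h *: v) - f u)) =
    (fun h : R => h^-1 *: (((fun s : R => f (s *: v + u)) \o shift (0 : R)) (h *: 1) - f (0 *: v + u))).
  by apply/funext => h /=; rewrite scale0r add0r addr0 [h *: 1]mulr1.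
split=> -[]; rewrite /derivable /derive.
  by rewrite E => df <-; exact: (DeriveDef df).
by rewrite -E => df <-; exact: (DeriveDef df).
Qed.

Lemma is_derive_ln_comp f u v D : 0 < f u -> is_derive u v f D ->
  is_derive u v (fun w => ln (f w)) (D / f u).
Proof.
move=> fu0 /is_derive_restrict_line df; apply/is_derive_restrict_line.
rewrite mulrC.
have dln : is_derive ((fun s : R => f (s *: v + u)) 0) 1 (@ln R) (f u)^-1.
  by rewrite scale0r add0r; exact: is_derive1_ln.
exact: (is_derive1_comp dln df).
Qed.

Lemma C1_is_derive f i u : C1 f -> is_derive u (e i) f (partial i f u).
Proof. by move=> [df _]; apply: (DeriveDef (diff_derivable (df u))). Qed.

Lemma C1_continuous f : C1 f -> continuous f.
Proof. by move=> [df _] u; exact: differentiable_continuous. Qed.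

Lemma partial_ln r i u : C1 r -> 0 < r u ->
  partial i (fun v => ln (r v)) u = partial i r u / r u.
Proof. by move=> C1r r0; have [_] := is_derive_ln_comp r0 (C1_is_derive i u C1r). Qed.

(** The factor [r] cancels the denominator of [grad (ln r)], so the flux is as smooth
    as the gradients of [Phi] and [r]. *)
Lemma fp_fluxE Phi r u i : C1 r -> (forall u, 0 < r u) ->
  fp_flux Phi r u ord0 i = \sum_j covmx r j i * (r u * partial j Phi u + partial j r u).
Proof.
move=> C1r r0; rewrite /fp_flux !mxE !mulr_sumr -big_split; apply: eq_bigr => j _.
rewrite !mxE partial_ln//=; field; rewrite gt_eqF//.
Qed.

Section fixed_time.
Variables (Phi r : 'rV[R]_n -> R) (alpha c : R).
Hypotheses (alpha0 : 0 < alpha).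
Hypotheses (C2Phi : C2 Phi) (C2r : C2 r) (r0 : forall u, 0 < r u).
Hypothesis cov : loewner_le alpha%:M (covmx r).

Let C1Phi : C1 Phi := C2Phi.1.
Let C1r : C1 r := C2r.1.
Let cPhi : continuous Phi := C1_continuous C1Phi.
Let cr : continuous r := C1_continuous C1r.
Let cdPhi i : continuous (partial i Phi) := C1Phi.2 i.
Let cdr i : continuous (partial i r) := C1r.2 i.
Let rn0 u : r u != 0. Proof. by rewrite gt_eqF. Qed.

Let h u := ln (r u) + Phi u + c.
Let dh i u := partial i r u / r u + partial i Phi u.

Let hd i u : is_derive u (e i) h (dh i u).
Proof.
have dPhi := C1_is_derive i u C1Phi.
have dr := is_derive_ln_comp (r0 u) (C1_is_derive i u C1r).
have := is_deriveD (is_deriveD dr dPhi) (is_derive_cst c u (e i)).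
by rewrite addr0.
Qed.

Let DJ i u := \sum_j covmx r j i *
  (r u * partial i (partial j Phi) u + partial j Phi u * partial i r u + partial i (partial j r) u).

Let dflux i u : is_derive u (e i) (fun v => fp_flux Phi r v ord0 i) (DJ i u).
Proof.
rewrite (_ : (fun v => _) = \sum_j covmx r j i \*: (r * partial j Phi + partial j r)); last first.
  by apply/funext => v; rewrite fp_fluxE// fct_sumE.
have dterm j : is_derive u (e i) (covmx r j i \*: (r * partial j Phi + partial j r))
    (covmx r j i * (r u * partial i (partial j Phi) u + partial j Phi u * partial i r u +
     partial i (partial j r) u)).
  have d1 := C1_is_derive i u C1r.
  have d2 := C1_is_derive i u (C2Phi.2 j).
  have d3 := C1_is_derive i u (C2r.2 j).
  exact: (is_deriveZ (covmx r j i) (is_deriveD (is_deriveM d1 d2) d3)).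
exact: is_derive_sum.
Qed.

Let divergenceE u : divergence (fp_flux Phi r) u = \sum_i DJ i u.
Proof. by apply: eq_bigr => i _; rewrite /partial; have [_ ->] := dflux i u. Qed.

Let cddPhi i j : continuous (partial i (partial j Phi)) := (C2Phi.2 j).2 i.
Let cddr i j : continuous (partial i (partial j r)) := (C2r.2 j).2 i.

Let cDJ i : continuous (DJ i).
Proof. by rewrite /DJ; cont. Qed.

Lemma continuous_flux i : continuous (fun v => fp_flux Phi r v ord0 i).
Proof.
rewrite (_ : (fun v => _) = fun v => \sum_j covmx r j i * (r v * partial j Phi v + partial j r v)).
  by cont.
by apply/funext => v; rewrite fp_fluxE.
Qed.

Let cflux := continuous_flux.

Let cdh i : continuous (dh i).
Proof. by rewrite /dh; cont. Qed.

Let ch : continuous h.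
Proof. by rewrite /h; cont. Qed.

Lemma continuous_divergence_flux : continuous (divergence (fp_flux Phi r)).
Proof.
rewrite (_ : divergence _ = fun u => \sum_i DJ i u); first by cont.
by apply/funext => u; rewrite divergenceE.
Qed.

Let dissE u : \sum_i fp_flux Phi r u ord0 i * dh i u = r u * qform (covmx r) (\row_i dh i u).
Proof.
have xE j : (\row_i dh i u) ord0 j = dh j u by rewrite mxE.
rewrite qformE exchange_big/= mulr_sumr; apply: eq_bigr => i _.
rewrite fp_fluxE// mulr_suml mulr_sumr; apply: eq_bigr => j _.
by rewrite !xE /dh; field.
Qed.

Let diss_ge u : alpha * (r u * \sum_i dh i u ^+ 2) <=
  \sum_i fp_flux Phi r u ord0 i * dh i u.
Proof.
rewrite dissE mulrCA ler_pM2l//.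
have := loewner_le_scalar (\row_i dh i u) cov; congr (_ * _ <= _).
by apply: eq_bigr => i _; rewrite mxE.
Qed.

Hypothesis int_div :
  mu.-integrable setT (EFin \o (fun u => h u * divergence (fp_flux Phi r) u)).
Hypothesis int_flux : forall i,
  mu.-integrable setT (EFin \o (fun u => h u * fp_flux Phi r u ord0 i)).

Let D := - \int[mu]_u (h u * divergence (fp_flux Phi r) u).

(** The flux is [r * C(r) grad h], so [<flux, grad h>] is at least
    [alpha * r * |grad h|^2], and [cube_dissipation] applies. *)
Lemma cube_fisher_le (s : nat) :
  \int[mu]_(u in cube s.+1%:R n) (r u * \sum_i dh i u ^+ 2) <= D / alpha.
Proof.
rewrite ler_pdivlMr// mulrC -cube_intZ; last by cont.
have := @cube_dissipation R n h (fun i v => fp_flux Phi r v ord0 i) DJ dh s.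
have -> : (fun u => h u * \sum_i DJ i u) = (fun u => h u * divergence (fp_flux Phi r) u).
  by apply/funext => u; rewrite divergenceE.
move=> /(_ ch cflux cDJ cdh dflux hd int_div int_flux) H.
apply: le_trans (H _).
  by apply: cube_int_le => [||u _]; [by cont|by cont|exact: diss_ge].
move=> u; apply: le_trans (diss_ge u); apply: mulr_ge0; first exact: ltW.
by apply: mulr_ge0; [exact: ltW|apply: sumr_ge0 => i _; exact: sqr_ge0].
Qed.

End fixed_time.
End entropy_production.

(** * The Gibbs density and pointwise entropy inequalities *)

Section gibbs_measure.
Context {R : realType} {n : nat}.
Local Notation mu := (@lebesgue_rV R n).
Variables (Phi : 'rV[R]_n -> R) (lam : R).
Hypotheses (lam0 : 0 < lam) (C2Phi : C2 Phi).
Hypothesis hess : forall u, loewner_le lam%:M (hessian Phi u).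

Let cPhi : continuous Phi := C1_continuous C2Phi.1.
Let Z := \int[mu]_v expR (- Phi v).

Let cexp : continuous (fun u => expR (- Phi u)).
Proof. by cont. Qed.

Let int_exp : mu.-integrable setT (EFin \o (fun u => expR (- Phi u))).
Proof. exact: integrable_expRN lam0 C2Phi hess cPhi. Qed.

Lemma partition_gt0 : 0 < Z.
Proof.
apply: (@lt_le_trans _ _ (\int[mu]_(u in cube 1 n) expR (- Phi u))).
  by apply: cube_int_gt0 => // u; exact: expR_gt0.
have mQ := measurable_cube (1 : R) n.
rewrite /Rintegral fine_le//.
- by apply: integrable_fin_num => //; exact: integrable_cube.
- exact: integrable_fin_num.
apply: ge0_subset_integral => //; first by have /integrableP[] := int_exp.
Qed.

Lemma gibbs_gt0 u : 0 < gibbs Phi u.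
Proof. by rewrite divr_gt0 ?expR_gt0// partition_gt0. Qed.

Lemma ln_gibbs u : ln (gibbs Phi u) = - Phi u - ln Z.
Proof. by rewrite ln_div ?posrE ?expR_gt0 ?partition_gt0// expRK. Qed.

Lemma continuous_gibbs : continuous (gibbs Phi).
Proof. by apply: ctsM => //; exact: cst_continuous. Qed.

Lemma integrable_gibbs : mu.-integrable setT (EFin \o gibbs Phi).
Proof.
rewrite (_ : EFin \o _ = fun u => (Z^-1%:E * (expR (- Phi u))%:E)%E).
  exact: integrableZl.
by apply/funext => u; rewrite /= /gibbs mulrC EFinM.
Qed.

Lemma integral_gibbs : \int[mu]_u gibbs Phi u = 1.
Proof. by rewrite RintegralZr// mulfV// gt_eqF// partition_gt0. Qed.

End gibbs_measure.

Section relative_entropy.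
Context {R : realType}.

(** With [a] and [b] the square roots of [x] and [y], this is [ln (b / a) <= b / a - 1]
    multiplied by [2 * a ^+ 2]. *)
Lemma hellinger_le_entropy (x y : R) : 0 < x -> 0 < y ->
  (Num.sqrt x - Num.sqrt y) ^+ 2 <= x * (ln x - ln y) - x + y.
Proof.
move=> x0 y0; set a := Num.sqrt x; set b := Num.sqrt y.
have a0 : 0 < a by rewrite sqrtr_gt0.
have b0 : 0 < b by rewrite sqrtr_gt0.
have xE : x = a ^+ 2 by rewrite sqr_sqrtr ?ltW.
have yE : y = b ^+ 2 by rewrite sqr_sqrtr ?ltW.
have lnx : ln x = ln a + ln a by rewrite xE expr2 lnM.
have lny : ln y = ln b + ln b by rewrite yE expr2 lnM.
have : ln b - ln a <= b / a - 1.
  by rewrite -ln_div ?posrE// ln_le_subr1// divr_gt0.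
rewrite -(ler_pM2l (exprn_gt0 2 a0)) mulrBr mulrBr [X in _ <= X - _](_ : _ = a * b); last first.
  by field; rewrite gt_eqF.
by rewrite lnx lny xE yE; lra.
Qed.

Lemma entropy_ge0 (x y : R) : 0 < x -> 0 < y -> 0 <= x * (ln x - ln y) - x + y.
Proof. by move=> x0 y0; apply: le_trans (hellinger_le_entropy x0 y0); exact: sqr_ge0. Qed.

(** Write [|x - y| = |a - b| * (a + b)] with [a] and [b] the square roots, apply
    [z * w <= z ^+ 2 / (2 * eps) + eps / 2 * w ^+ 2], and compare [|a - b| ^+ 2] with
    the entropy. *)
Lemma dist_le_entropy (x y eps : R) : 0 < x -> 0 < y -> 0 < eps ->
  `|x - y| <= (2 * eps)^-1 * (x * (ln x - ln y) - x + y) + eps * (x + y).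
Proof.
move=> x0 y0 eps0; set a := Num.sqrt x; set b := Num.sqrt y.
have hell := hellinger_le_entropy x0 y0.
have xE : x = a ^+ 2 by rewrite sqr_sqrtr ?ltW.
have yE : y = b ^+ 2 by rewrite sqr_sqrtr ?ltW.
have ab0 : 0 <= a + b by rewrite addr_ge0 ?sqrtr_ge0.
apply: (@le_trans _ _ ((2 * eps)^-1 * (a - b) ^+ 2 + eps * (x + y))); last first.
  by rewrite lerD2r ler_pM2l// invr_gt0 mulr_gt0.
have -> : `|x - y| = `|a - b| * (a + b).
  by rewrite xE yE subr_sqr normrM (ger0_norm ab0).
rewrite -(real_normK (num_real (a - b))); set z := `|a - b|.
rewrite -subr_ge0 xE yE [leRHS](_ : _ = (2 * eps)^-1 * (z - eps * (a + b)) ^+ 2 +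
    eps / 2 * (a - b) ^+ 2); last by field; rewrite gt_eqF.
by rewrite addr_ge0// mulr_ge0 ?sqr_ge0// ?invr_ge0 ?divr_ge0 ?mulr_ge0// ltW.
Qed.
End relative_entropy.

(** * Entropy against dissipation *)

Section entropy_le_production.
Context {R : realType} {n : nat}.
Local Notation mu := (@lebesgue_rV R n).

(** On each cube, the logarithmic Sobolev inequality and [cube_fisher_le] bound the
    entropy of the restrictions by [D / (2 * alpha * lam)] up to terms that depend on
    the masses only and vanish in the limit.  Completing the entropy density to the
    nonnegative [E] gives access to monotone convergence, hence integrability. *)
Lemma entropy_le_production (Phi r : 'rV[R]_n -> R) (alpha lam c : R) :
  0 < alpha -> 0 < lam -> C2 Phi -> C2 r -> (forall u, 0 < r u) ->
  (forall u, loewner_le lam%:M (hessian Phi u)) -> loewner_le alpha%:M (covmx r) ->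
  mu.-integrable setT (EFin \o r) -> \int[mu]_u r u = 1 ->
  mu.-integrable setT (EFin \o
    (fun u => (ln (r u) + Phi u + c) * divergence (fp_flux Phi r) u)) ->
  (forall i, mu.-integrable setT (EFin \o
    (fun u => (ln (r u) + Phi u + c) * fp_flux Phi r u ord0 i))) ->
  mu.-integrable setT (EFin \o (fun u => r u * (ln (r u) - ln (gibbs Phi u)))) /\
  2 * alpha * lam * \int[mu]_u (r u * (ln (r u) - ln (gibbs Phi u))) <=
  - \int[mu]_u ((ln (r u) + Phi u + c) * divergence (fp_flux Phi r) u).
Proof.
move=> alpha0 lam0 C2Phi C2r r0 hess cov int_r r1 int_div int_flux.
set D := - _.
pose G := gibbs Phi; pose Z := \int[mu]_v expR (- Phi v).
have G0 u : 0 < G u by exact: gibbs_gt0 lam0 C2Phi hess u.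
have lnG u : ln (G u) = - Phi u - ln Z by exact: ln_gibbs lam0 C2Phi hess u.
have cG : continuous G by exact: continuous_gibbs C2Phi.
have int_G : mu.-integrable setT (EFin \o G) by exact: integrable_gibbs lam0 C2Phi hess.
have G1 : \int[mu]_u G u = 1 by exact: integral_gibbs lam0 C2Phi hess.
have cr : continuous r by exact: C1_continuous C2r.1.
have cPhi : continuous Phi by exact: C1_continuous C2Phi.1.
have cdPhi i : continuous (partial i Phi) := C2Phi.1.2 i.
have cdr i : continuous (partial i r) := C2r.1.2 i.
have rn0 u : r u != 0 by rewrite gt_eqF.
pose H u := r u * (ln (r u) - ln (G u)).
pose F u := r u * \sum_i (partial i r u / r u + partial i Phi u) ^+ 2.
have cF : continuous F by rewrite /F; cont.
have cH : continuous H by rewrite /H; cont.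
pose mr (k : nat) := \int[mu]_(u in cube k.+1%:R n) r u.
pose mG (k : nat) := \int[mu]_(u in cube k.+1%:R n) G u.
have LS k : \int[mu]_(u in cube k.+1%:R n) (H u - (2 * lam)^-1 * F u) <=
    mr k * (ln (mr k) - ln (mG k)).
  have := @cube_logsobolev R n k.+1%:R lam r G (fun u => - Phi u - ln Z)
    (fun i => partial i r) (fun i u => - partial i Phi u) (ltr0Sn _ _) lam0 cr cG.
  have E u : r u * (ln (r u) - (- Phi u - ln Z) - (2 * lam)^-1 *
      \sum_i (- partial i Phi u - partial i r u / r u) ^+ 2) = H u - (2 * lam)^-1 * F u.
    rewrite /H /F lnG; under eq_bigr do rewrite -opprD sqrrN addrC.
    by ring.
  under eq_Rintegral => u _ do rewrite E.
  apply=> //.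
  - by cont.
  - by move=> i; cont.
  - by move=> i u; exact: C1_is_derive C2r.1.
  - move=> x y; rewrite lnG; have := strong_convexity C2Phi hess x y.
    under [X in _ <= _ - _ + X - _]eq_bigr do rewrite mulNr.
    by rewrite sumrN; lra.
have FD k : \int[mu]_(u in cube k.+1%:R n) F u <= D / alpha.
  exact: (@cube_fisher_le _ _ Phi r alpha c).
pose E u := H u - r u + G u.
have cE : continuous E by rewrite /E; cont.
have E0 u : 0 <= E u by exact: entropy_ge0.
pose B k := D / (2 * alpha * lam) + mr k * (ln (mr k) - ln (mG k)) - mr k + mG k.
have EB k : \int[mu]_(u in cube k.+1%:R n) E u <= B k.
  rewrite cube_intD//; last by cont.
  rewrite cube_intB// /B lerD2r lerD2r.
  have := LS k; rewrite cube_intB//; last by cont.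
  rewrite cube_intZ//; set x := \int[mu]_(u in _) H u; set y := \int[mu]_(u in _) F u.
  move=> h1; have h2 : (2 * lam)^-1 * y <= D / (2 * alpha * lam).
    rewrite (_ : D / _ = (2 * lam)^-1 * (D / alpha)).
      by rewrite ler_pM2l ?FD// invr_gt0 mulr_gt0.
    by field; rewrite !gt_eqF.
  by lra.
have BD : B k @[k --> \oo] --> D / (2 * alpha * lam).
  rewrite [X in _ --> X](_ : _ = D / (2 * alpha * lam) + 1 * (ln 1 - ln 1) - 1 + 1); last first.
    by rewrite subrr mulr0 addr0 subrK.
  have mr1 : mr k @[k --> \oo] --> (1 : R) by rewrite -r1; exact: cvg_cube_int1.
  have mG1 : mG k @[k --> \oo] --> (1 : R) by rewrite -[X in _ --> X]G1; exact: cvg_cube_int1.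
  have cln1 : {for (1 : R), continuous (@ln R)} by exact: continuous_ln.
  have lnr1 := cvg_comp mr (@ln R) mr1 cln1.
  have lnG1 := cvg_comp mG (@ln R) mG1 cln1.
  by apply: cvgD => //; apply: cvgB => //; apply: cvgD;
    [exact: cvg_cst|apply: cvgM => //; exact: cvgB].
have [int_E ED] := cube_int_bounded cE E0 EB BD.
have HE : (fun u => H u) = (fun u => E u + (r u - G u)).
  by apply/funext => u; rewrite /E; ring.
have int_rG : mu.-integrable setT (EFin \o (fun u => r u - G u)) by exact: integrable_subr.
have int_H : mu.-integrable setT (EFin \o H) by rewrite [H]HE; exact: integrable_addr.
split=> //.
have -> : \int[mu]_u (r u * (ln (r u) - ln (gibbs Phi u))) = \int[mu]_u E u.
  rewrite -[LHS]/(\int[mu]_u H u) HE RintegralD// RintegralB// r1 G1 subrr addr0//.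
by rewrite mulrC -ler_pdivlMr// !mulr_gt0.
Qed.
End entropy_le_production.

(** * From entropy to the L^1 distance, and a Gronwall lemma *)

Section L1_entropy.
Context {R : realType} {n : nat}.
Local Notation mu := (@lebesgue_rV R n).

(** Since both densities have mass one, the entropy is the integral of the nonnegative
    function of [hellinger_le_entropy], and [dist_le_entropy] can be integrated. *)
Lemma L1_le_entropy (r g : 'rV[R]_n -> R) :
  (forall u, 0 < r u) -> (forall u, 0 < g u) ->
  mu.-integrable setT (EFin \o r) -> mu.-integrable setT (EFin \o g) ->
  \int[mu]_u r u = 1 -> \int[mu]_u g u = 1 ->
  mu.-integrable setT (EFin \o (fun u => r u * (ln (r u) - ln (g u)))) ->
  0 <= \int[mu]_u (r u * (ln (r u) - ln (g u))) /\
  forall eps, 0 < eps -> \int[mu]_u `|r u - g u| <=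
    (2 * eps)^-1 * \int[mu]_u (r u * (ln (r u) - ln (g u))) + 2 * eps.
Proof.
move=> r0 g0 int_r int_g r1 g1 int_H.
set H := fun u => r u * (ln (r u) - ln (g u)).
have int_Hr : mu.-integrable setT (EFin \o (fun u => H u - r u)) by exact: integrable_subr.
have int_E : mu.-integrable setT (EFin \o (fun u => H u - r u + g u)) by exact: integrable_addr.
have HE : \int[mu]_u H u = \int[mu]_u (H u - r u + g u).
  by rewrite RintegralD// RintegralB// r1 g1 subrK.
split; first by rewrite HE; apply: Rintegral_ge0 => u _; exact: entropy_ge0.
move=> eps eps0.
have int_rg : mu.-integrable setT (EFin \o (fun u => r u + g u)) by exact: integrable_addr.
have -> : (2 * eps)^-1 * \int[mu]_u H u + 2 * eps =
    \int[mu]_u ((2 * eps)^-1 * (H u - r u + g u) + eps * (r u + g u)).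
  rewrite RintegralD//; [|exact: integrable_scaler|exact: integrable_scaler].
  rewrite RintegralZl// RintegralZl// -HE (RintegralD measurableT int_r int_g) r1 g1.
  by congr (_ + _); rewrite mulrC.
apply: le_Rintegral => //.
- by apply: eq_integrable (integrable_abse (integrable_subr int_r int_g)).
- by apply: integrable_addr; exact: integrable_scaler.
- by move=> u _; exact: dist_le_entropy.
Qed.

End L1_entropy.

Section gronwall.
Context {R : realType}.

(** [H t * expR (a * t)] has a nonpositive derivative. *)
Lemma exp_decay (H H' : R -> R) (a : R) :
  (forall t : R, 0 < t -> is_derive t 1 H (H' t)) ->
  (forall t, 0 < t -> H' t <= - a * H t) ->
  forall s t, 0 < s -> s <= t -> H t * expR (a * t) <= H s * expR (a * s).
Proof.
move=> dH H'le s t s0 st.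
pose K x := H x * expR (a * x).
have dK (x : R) : 0 < x -> is_derive x 1 K ((H' x + a * H x) * expR (a * x)).
  move=> x0; have dHx := dH x x0.
  have dax : is_derive x 1 (fun y : R => a * y) a.
    have := is_deriveZ a (is_derive_id x (1 : R)).
    by rewrite [_ *: 1]mulr1.
  have dex := is_derive1_comp (is_derive_expR (a * x)) dax.
  have := is_deriveM dHx dex.
  rewrite [X in is_derive _ _ _ X -> _](_ : _ = (H' x + a * H x) * expR (a * x))//.
  by rewrite /=/GRing.scale/=; ring.
have K'le x : 0 < x -> (H' x + a * H x) * expR (a * x) <= 0.
  move=> x0; rewrite pmulr_lle0 ?expR_gt0//.
  by have := H'le x x0; lra.
have pos x : s <= x -> 0 < x by exact: lt_le_trans.
apply: (@ler0_derive1_nincr R K s t _ _ _ s t) => //.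
- by move=> x; rewrite in_itv/= => /andP[/ltW/pos x0 _]; have [] := dK x x0.
- move=> x; rewrite in_itv/= => /andP[/ltW/pos x0 _]; rewrite derive1E.
  by have [_ ->] := dK x x0; exact: K'le.
- apply: derivable_within_continuous => x; rewrite in_itv/= => /andP[/pos x0 _].
  by have [] := dK x x0.
Qed.
End gronwall.

(** * Exponential decay along a solution *)

Section exponential_decay.
Context {R : realType} {n : nat}.
Local Notation mu := (@lebesgue_rV R n).

Lemma coord_le_enorm (v : 'rV[R]_n) i : `|v ord0 i| <= enorm v.
Proof.
rewrite -sqrtr_sqr /enorm ler_sqrt ?sumr_ge0// => [|j _]; last exact: sqr_ge0.
by rewrite (bigD1 i)//= lerDl sumr_ge0// => j _; exact: sqr_ge0.
Qed.

Lemma density2_integrable (f : 'rV[R]_n -> R) : density2 f ->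
  mu.-integrable setT (EFin \o f) /\ \int[mu]_u f u = 1.
Proof.
move=> [mf f0 f1 _]; split; last by rewrite /Rintegral f1.
apply/integrableP; split; first exact/measurable_EFinP.
under eq_integral do rewrite /= ger0_norm//.
by rewrite f1 ltry.
Qed.

Section solution.
Variables (Phi rho0 : 'rV[R]_n -> R) (rho : R -> 'rV[R]_n -> R) (alpha lam : R).
Hypotheses (C2Phi : C2 Phi) (sol : fp_solution Phi rho0 rho).
Hypotheses (alpha0 : 0 < alpha) (lam0 : 0 < lam).
Hypothesis cov : forall t : R, 0 <= t -> loewner_le alpha%:M (covmx (rho t)).
Hypothesis hess : forall u, loewner_le lam%:M (hessian Phi u).

Let g := gibbs Phi.
Let reg := fp_reg sol.
Let lnZ := ln (\int[mu]_v expR (- Phi v)).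
Let a := 2 * alpha * lam.

Let cPhi : continuous Phi := C1_continuous C2Phi.1.
Let g0 u : 0 < g u. Proof. exact: gibbs_gt0 lam0 C2Phi hess u. Qed.
Let lng u : ln (g u) = - Phi u - lnZ. Proof. exact: ln_gibbs lam0 C2Phi hess u. Qed.

(** The additive constant makes [h] the derivative of [x * (ln x - ln g)] at
    [x = rho]. *)
Let h t u := ln (rho t u) + Phi u + (lnZ + 1).

Let h_le t u : `|h t u| <= (1 + `|lnZ + 1|) * (1 + `|Phi u| + `|ln (rho t u)|).
Proof.
apply: (le_trans (ler_normD _ _)); apply: (le_trans (lerD (ler_normD _ _) (lexx _))).
have := normr_ge0 (lnZ + 1); have := normr_ge0 (Phi u); have := normr_ge0 (ln (rho t u)).
by nra.
Qed.

Let c1rho t (t0 : 0 < t) : continuous (rho t) := C1_continuous (fp_C2 reg t0).1.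

Let ch t (t0 : 0 < t) : continuous (h t).
Proof.
by have cr := c1rho t0; have r0 u := fp_pos reg u t0; rewrite /h; cont.
Qed.

Let int_div t : 0 < t -> mu.-integrable setT
  (EFin \o (fun u => h t u * divergence (fp_flux Phi (rho t)) u)).
Proof.
move=> t0; have [b ib hb] := fp_dom reg t0 (lexx t).
apply: (integrable_bound (M := 1 + `|lnZ + 1|) _ ib).
  apply: continuous_measurable_rV; apply: ctsM; first exact: ch.
  exact: continuous_divergence_flux C2Phi (fp_C2 reg t0) (fun u => fp_pos reg u t0).
move=> u; rewrite normrM -(fp_eq sol)//.
apply: (@le_trans _ _ ((1 + `|lnZ + 1|) * (1 + `|Phi u| + `|ln (rho t u)|) *
    `|'D_1 (rho ^~ u) t|)); first by rewrite ler_wpM2r.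
by rewrite -mulrA ler_pM2l ?ltr_pwDl// mulrC hb// lexx.
Qed.

Let int_flux t i : 0 < t -> mu.-integrable setT
  (EFin \o (fun u => h t u * fp_flux Phi (rho t) u ord0 i)).
Proof.
move=> t0; apply: (integrable_bound (M := 1 + `|lnZ + 1|) _ (fp_decay reg t0)).
  apply: continuous_measurable_rV; apply: ctsM; first exact: ch.
  exact: continuous_flux C2Phi (fp_C2 reg t0) (fun u => fp_pos reg u t0) i.
move=> u; rewrite normrM mulrC.
apply: (@le_trans _ _ (enorm (fp_flux Phi (rho t) u) * ((1 + `|lnZ + 1|) *
    (1 + `|Phi u| + `|ln (rho t u)|)))); first by rewrite ler_pM// coord_le_enorm.
by rewrite mulrCA.
Qed.

Definition entropy t := \int[mu]_u (rho t u * (ln (rho t u) - ln (g u))).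
Let H := entropy.

Let H' t := \int[mu]_u (h t u * divergence (fp_flux Phi (rho t)) u).

Let entropy_facts t : 0 < t ->
  mu.-integrable setT (EFin \o (fun u => rho t u * (ln (rho t u) - ln (g u)))) /\
  H' t <= - a * H t.
Proof.
move=> t0; have [ir r1] := density2_integrable (fp_density sol (ltW t0)).
have [iH HD] := entropy_le_production alpha0 lam0 C2Phi (fp_C2 reg t0)
  (fun u => fp_pos reg u t0) hess (cov (ltW t0)) ir r1 (int_div t0) (fun i => int_flux i t0).
by split=> //; rewrite mulNr lerNr.
Qed.

(** Differentiation under the integral sign; the dominating function comes from
    [fp_dom] on the interval from [t / 2] to [2 * t]. *)
Let dH (t : R) : 0 < t -> is_derive t 1 H (H' t).
Proof.
move=> t0.
have t20 : 0 < t / 2 by rewrite divr_gt0.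
have tt : t / 2 <= 2 * t by lra.
have [b ib hb] := fp_dom reg t20 tt.
pose f (s : R) u := rho s u * (ln (rho s u) - ln (g u)).
have dr (s : R) u : 0 < s -> is_derive s 1 (rho ^~ u) ('D_1 (rho ^~ u) s).
  by move=> s0; apply: DeriveDef; first exact: (fp_dt reg).
have df (s : R) u : 0 < s -> is_derive s 1 (f ^~ u) ('D_1 (rho ^~ u) s * h s u).
  move=> s0; have r0 := fp_pos reg u s0; have drs := dr s u s0.
  have dln := is_derive1_comp (is_derive1_ln r0) drs.
  have := is_deriveM drs (is_deriveB dln (is_derive_cst (ln (g u)) s (1 : R))).
  rewrite [X in is_derive _ _ _ X -> _](_ : _ = 'D_1 (rho ^~ u) s * h s u)//.
  transitivity (rho s u * ((rho s u)^-1 * 'D_1 (rho ^~ u) s - 0) +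
    (ln (rho s u) - ln (g u)) * 'D_1 (rho ^~ u) s); first by [].
  by rewrite /h lng; field; rewrite gt_eqF.
have I0 s : `]t / 2, (2 * t)[%classic s -> 0 < s.
  by rewrite /= in_itv/= => /andP[st _]; exact: lt_trans st.
have It : `]t / 2, (2 * t)[%classic t by rewrite /= in_itv/=; apply/andP; split; lra.
have intf s : `]t / 2, (2 * t)[%classic s -> mu.-integrable setT (EFin \o f s).
  by move=> /I0 /entropy_facts[].
have derf s u : `]t / 2, (2 * t)[%classic s -> setT u -> derivable (f ^~ u) s 1.
  by move=> /I0 s0 _; have [] := df s u s0.
pose M := 1 + `|lnZ + 1|.
have M0 : 0 <= M by rewrite addr_ge0.
have G0 u : 0 <= M * b u.
  rewrite mulr_ge0//; apply: le_trans (hb t u _); first by rewrite mulr_ge0// addr_ge0// addr_ge0.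
  by apply/andP; split; lra.
have iG : mu.-integrable setT (EFin \o (fun u => M * b u)) by exact: integrable_scaler.
have Gub s u : `]t / 2, (2 * t)[%classic s -> setT u -> `|partial1of2 f s u| <= M * b u.
  move=> sI _; have s0 := I0 s sI; rewrite partial1of2E.
  have [_ ->] := df s u s0; rewrite normrM.
  apply: (@le_trans _ _ (`|'D_1 (rho ^~ u) s| * (M * (1 + `|Phi u| + `|ln (rho s u)|)))).
    by rewrite ler_wpM2l.
  rewrite mulrCA ler_wpM2l// hb//.
  by move: sI; rewrite /= in_itv/= => /andP[/ltW -> /ltW ->].
have dF := @derivable_under_integral R _ _ mu f setT measurableT t _ _ It intf derf _ G0 iG Gub.
have FE := @differentiation_under_integral R _ _ mu f setT measurableT t _ _ It intf derf _ G0 iG Gub.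
apply: (DeriveDef dF); rewrite -derive1E FE; apply: eq_Rintegral => u _.
rewrite -[LHS]/(partial1of2 f t u) partial1of2E; have [_ ->] := df t u t0.
by rewrite (fp_eq sol)// mulrC.
Qed.

Let L1_entropy t : 0 < t -> 0 <= H t /\ forall eps, 0 < eps ->
  \int[mu]_u `|rho t u - g u| <= (2 * eps)^-1 * H t + 2 * eps.
Proof.
move=> t0; have [ir r1] := density2_integrable (fp_density sol (ltW t0)).
apply: (L1_le_entropy (fun u => fp_pos reg u t0) g0 ir _ r1 _ (entropy_facts t0).1).
  exact: integrable_gibbs lam0 C2Phi hess.
exact: integral_gibbs lam0 C2Phi hess.
Qed.

Let KL_entropy t : 0 < t -> KL (rho t) g = (H t)%:E.
Proof.
move=> t0; rewrite /KL /H /entropy /Rintegral fineK; last first.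
  by apply: integrable_fin_num => //; exact: (entropy_facts t0).1.
by apply: eq_integral => u _; rewrite ln_div// posrE// (fp_pos reg u t0).
Qed.

Hypothesis KL_fin : (KL rho0 g < +oo)%E.

(** [exp_decay] is applied from time [s] to time [t], and [s] tends to [0]: this is
    where the initial value is attained in relative entropy. *)
Lemma entropy_decay t : 0 < t -> H t <= fine (KL rho0 g) * expR (- (a * t)).
Proof.
move=> t0.
have KLcvg : (H s)%:E @[s --> 0^'+] --> KL rho0 g.
  apply: cvg_trans (fp_init_KL sol); apply: near_eq_cvg; near=> s.
  by rewrite KL_entropy.
have KL0 : (0 <= KL rho0 g)%E.
  apply: (cvge_ge _ KLcvg); near=> s; rewrite lee_fin.
  by have [] := @L1_entropy s _.
have KLE : KL rho0 g = (fine (KL rho0 g))%:E by rewrite fineK// ge0_fin_numE.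
have Hcvg : H s @[s --> 0^'+] --> fine (KL rho0 g).
  by have := KLcvg; rewrite [X in _ --> X]KLE => /fine_cvg.
have expcvg : expR (a * s) @[s --> 0^'+] --> (1 : R).
  have cexp : continuous (fun s : R => expR (a * s)).
    by apply: cts_expR; apply: ctsM => [|s]; [exact: cst_continuous|exact: cvg_id].
  rewrite -[X in _ --> X]expR0 -[X in expR X](mulr0 a).
  exact: cvg_at_right_filter (cexp 0).
have Kcvg : H s * expR (a * s) @[s --> 0^'+] --> fine (KL rho0 g).
  by rewrite -[X in _ --> X]mulr1; exact: cvgM.
rewrite expRN ler_pdivlMr ?expR_gt0//.
apply: (ler_cvg_to (cvg_cst (H t * expR (a * t))) Kcvg); near=> s.
have st : s <= t by near: s; exact: nbhs_right_le.
by apply: (exp_decay dH) => // x x0; exact: (entropy_facts x0).2.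
Unshelve. all: by end_near. Qed.

(** [L1_le_entropy] with [eps = expR (- (alpha * lam * t))], the square root of the
    decay factor of the entropy. *)
Lemma L1_decay t : 0 < t ->
  (L1dist (rho t) g <= ((2 + `|fine (KL rho0 g)|) * expR (- (alpha * lam * t)))%:E)%E.
Proof.
move=> t0; have [_ /(_ (expR (- (alpha * lam * t))) (expR_gt0 _)) L1] := L1_entropy t0.
have [ir _] := density2_integrable (fp_density sol (ltW t0)).
rewrite /L1dist Lnorm1.
have -> : (\int[mu]_u `|(EFin \o (rho t \- g)%R) u| = (\int[mu]_u `|rho t u - g u|)%R%:E)%E.
  rewrite /Rintegral fineK//; apply: integrable_fin_num => //.
  have := integrable_abse (integrable_subr ir (integrable_gibbs lam0 C2Phi hess)).
  exact: eq_integrable.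
rewrite lee_fin (le_trans L1)// [leRHS]mulrDl [leRHS]addrC lerD2r.
set k := fine (KL rho0 g); set x := alpha * lam * t.
have Hk : H t <= `|k| * expR (- x) ^+ 2.
  apply: (le_trans (entropy_decay t0)).
  rewrite -expRM_natl (_ : - (a * t) = 2 * - x); last by rewrite /a /x; ring.
  by rewrite ler_wpM2r ?expR_ge0// ler_norm.
have e0 := expR_gt0 (- x).
rewrite ler_pdivrMl ?mulr_gt0// (le_trans Hk)//.
have := mulr_ge0 (normr_ge0 k) (sqr_ge0 (expR (- x))); lra.
Qed.

End solution.
End exponential_decay.

Theorem proposition2 (R : realType) (d K : nat)
    (G : 'rV[R]_d -> 'rV[R]_K) (y : 'rV[R]_K)
    (Gamma : 'M[R]_K) (Gamma0 : 'M[R]_d) (rho0 : 'rV[R]_d -> R)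
    (Gamma_spd : spd Gamma) (Gamma0_spd : spd Gamma0)
    (Phi_C2 : C2 (misfitR G y Gamma Gamma0))
    (rho0_density : density2 rho0)
    (KL_fin : (KL rho0 (gibbs (misfitR G y Gamma Gamma0)) < +oo)%E) :
  exists2 c : R, 0 < c &
    forall (rho : R -> 'rV[R]_d -> R) (alpha lambda : R),
      fp_solution (misfitR G y Gamma Gamma0) rho0 rho ->
      0 < alpha -> 0 < lambda ->
      (forall t : R, 0 <= t -> loewner_le alpha%:M (covmx (rho t))) ->
      (forall u, loewner_le lambda%:M (hessian (misfitR G y Gamma Gamma0) u)) ->
      forall t : R, 0 < t ->
        (L1dist (rho t) (gibbs (misfitR G y Gamma Gamma0)) <=
          (c * expR (- (alpha * lambda * t)))%:E)%E.
Proof.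
exists (2 + `|fine (KL rho0 (gibbs (misfitR G y Gamma Gamma0)))|).
  by rewrite ltr_pwDl.
move=> rho alpha lambda sol alpha0 lambda0 cov hess t t0.
exact: L1_decay Phi_C2 sol alpha0 lambda0 cov hess KL_fin t t0.
Qed.
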